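(* Let $E_1, E_2$ and $F$ be locally convex spaces, $U$ and $V$ be locally convex subsets with dense interior of $E_1$ and $E_2$ respectively, and $r,s \in \mathbb{N}_0 \cup \{\infty \}$. Assume that at least one of the following conditions is satisfied: (a) $V$ is locally compact. (b) $r=s=0$ and $U \times V$ is a $k$-space. (c) $r\geq 1$, $s=0$ and $U \times V \times E_1$ is a $k$-space. (d) $r=0$, $s\geq 1$ and $U \times V \times E_2$ is a $k$-space. (e) $r\geq 1$, $s\geq1$ and $U \times V \times E_1 \times E_2$ is a $k$-space. Then $$\Phi \colon C^{r,s}(U\times V,F)\to C^r(U,C^s(V,F)), \quad f \mapsto f^\vee,\qquad f^\vee(x):=f(x,\bullet),$$ is an isomorphism of topological vector spaces. Moreover, if $g\colon U \to C^s(V,F)$ is $C^r$, then $$g^\wedge \colon U \times V \to F,\quad g^\wedge (x,y):= g(x)(y)$$ is $C^{r,s}$.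
   Context: Locally convex spaces are real Hausdorff locally convex topological vector spaces. A subset $U$ of a locally convex space $E$ is called locally convex if every $x\in U$ has a convex neighbourhood in $U$. ''With dense interior'' means that the interior $U^\circ$ is dense in $U$. $C^r$-maps: For $f\colon U\to F$ with $U\subseteq E$ open, $D_hf(x):=\lim_{t\to0}t^{-1}(f(x+th)-f(x))$. The map $f$ is $C^r$ if for all $k\in\mathbb{N}_0$ with $k\le r$ the iterated directional derivatives $d^{(k)}f(x,y_1,\dots,y_k):=(D_{y_k}\cdots D_{y_1}f)(x)$ exist and define a continuous map $d^{(k)}f\colon U\times E^k\to F$. If $U$ is a locally convex subset with dense interior, $f\colon U\to F$ is $C^r$ if $f|_{U^\circ}$ is $C^r$ and each $d^{(k)}(f|_{U^\circ})$ extends to a (unique) continuous map $d^{(k)}f\colon U\times E^k\to F$ (with $d^{(0)}f=f$). $C^{r,s}$-maps: For $U\subseteq E_1$, $V\subseteq E_2$ open, $f\colon U\times V\to F$ is $C^{r,s}$ if for all $i,j\in\mathbb{N}_0$ with $i\le r$, $j\le s$ the iterated directional derivative $d^{(i,j)}f(x,y,w_1,\dots,w_i,v_1,\dots,v_j):=(D_{(w_i,0)}\cdots D_{(w_1,0)}D_{(0,v_j)}\cdots D_{(0,v_1)}f)(x,y)$ exists everywhere and $d^{(i,j)}f\colon U\times V\times E_1^i\times E_2^j\to F$ is continuous. If $U,V$ are locally convex subsets with dense interior, $f$ is $C^{r,s}$ if $f|_{U^\circ\times V^\circ}$ is $C^{r,s}$ and each $d^{(i,j)}(f|_{U^\circ\times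 V^\circ})$ extends to a continuous map $d^{(i,j)}f\colon U\times V\times E_1^i\times E_2^j\to F$ (with $d^{(0,0)}f=f$). Topologies: $C^r(U,F)$ carries the initial topology with respect to the maps $d^{(k)}\colon C^r(U,F)\to C(U\times E^k,F)$, $k\le r$; $C^{r,s}(U\times V,F)$ carries the initial topology with respect to the maps $d^{(i,j)}\colon C^{r,s}(U\times V,F)\to C(U\times V\times E_1^i\times E_2^j,F)$, $i\le r$, $j\le s$ (spaces of continuous maps with the compact-open topology). A topological space $X$ is a k-space if it is Hausdorff and its topology is the final topology with respect to the inclusion maps $K\to X$ of compact subsets $K\subseteq X$. *)

(* Defs.v *)
From HB Require Import structures.
From mathcomp Require Import all_boot all_order all_algebra.
From mathcomp Require Import all_classical all_reals topology convex tvs.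
From mathcomp Require Import interval_inference num_normedtype pseudometric_normed_Zmodule.
Import Order.TTheory GRing.Theory Num.Theory.
Import numFieldTopology.Exports.

Set Implicit Arguments.
Unset Strict Implicit.
Unset Printing Implicit Defensive.

Local Open Scope classical_set_scope.
Local Open Scope ring_scope.

HB.mixin Record isHausdorff T of Topological T := {
  lcs_hausdorff : hausdorff_space T
}.

(* [tvsType] already includes local convexity. *)
#[short(type="lcsType")]
HB.structure Definition LCS (R : numDomainType) :=
  {E of Tvs R E & isHausdorff E}.

Definition locally_convex_subset (R : realType) (E : lcsType R) (U : set E) :=
  forall x, U x ->
    exists W : set E, [/\ W `<=` U, convex_set W & within U (nbhs x) W].

Record lcsubset (R : realType) (E : lcsType R) := LCSubset {
  lcsubset_set :> set E;
  lcsubset_convex : locally_convex_subset lcsubset_set;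
  lcsubset_dense : lcsubset_set `<=` closure lcsubset_set°
}.

(* r in N u {oo}: [Some n] is the finite order n, [None] is oo *)
Definition order_le (k : nat) (r : option nat) : bool :=
  if r is Some n then (k <= n)%N else true.

Section directional_derivative.
Context {R : realType} {G : tvsType R} {F : lcsType R}.
Implicit Types (O : set G) (h x : G) (f : G -> F).

Definition is_dir_deriv f x h (l : F) :=
  t^-1 *: (f (x + t *: h) - f x) @[t --> (0 : R)^'] --> l.

Definition dir_derivable f x h := exists l, is_dir_deriv f x h l.

Definition dir_deriv h f : G -> F := fun x => xget 0 [set l | is_dir_deriv f x h l].

(* D_{h_k} ... D_{h_1} f for hs = [:: h_1; ...; h_k] *)
Fixpoint iter_deriv (hs : seq G) f : G -> F :=
  if hs is h :: hs' then iter_deriv hs' (dir_deriv h f) else f.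

Fixpoint iter_derivable O (hs : seq G) f : Prop :=
  if hs is h :: hs' then
    (forall x, O x -> dir_derivable f x h) /\
    iter_derivable O hs' (dir_deriv h f)
  else True.

(* For a family [dirs y] of direction lists: the iterated derivatives along
   [dirs y] exist on the open set O and are continuous on O x Y. *)
Definition cts_deriv (Y : topologicalType) (dirs : Y -> seq G) O f :=
  (forall y, iter_derivable O (dirs y) f) /\
  {within O `*` setT, continuous (fun p : G * Y => iter_deriv (dirs p.2) f p.1)}.

End directional_derivative.

Section tvs_lemmas.
Context {R : realType} {E : tvsType R}.

Lemma cvg_addr (T : Type) (G : set_system T) (f g : T -> E) (a b : E) : Filter G ->
  f @ G --> a -> g @ G --> b -> (fun x => f x + g x) @ G --> a + b.
Proof.
move=> FG fa gb.
apply: (@cvg_comp _ _ _ (fun x => (f x, g x)) (fun p : E * E => p.1 + p.2) G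
  (nbhs (a, b)) (nbhs (a + b))); first exact: cvg_pair.
exact: (@tvs.add_continuous E (a, b)).
Qed.

Lemma cvg_scaler (T : Type) (G : set_system T) (f : T -> E) (k : T -> R) (a : E) (b : R) :
  Filter G -> k @ G --> b -> f @ G --> a -> (fun x => k x *: f x) @ G --> b *: a.
Proof.
move=> FG kb fa.
apply: (@cvg_comp _ _ _ (fun x => (k x : R^o, f x))
  (fun p : R^o * E => p.1 *: p.2) G (nbhs (b : R^o, a)) (nbhs (b *: a))).
  exact: (@cvg_pair _ _ _ G (nbhs (b : R^o)) (nbhs a)).
exact: (@tvs.scale_continuous R E (b, a)).
Qed.

Lemma cvg_lin (T : Type) (G : set_system T) (f g : T -> E) (k : R) (a b : E) : Filter G ->
  f @ G --> a -> g @ G --> b -> (fun x => k *: f x + g x) @ G --> k *: a + b.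
Proof.
move=> FG fa gb; apply: cvg_addr => //; apply: cvg_scaler => //; exact: cvg_cst.
Qed.

End tvs_lemmas.

Section deriv_lemmas.
Context {R : realType} {G : tvsType R} {F : lcsType R}.
Implicit Types (O : set G) (h x : G) (f g : G -> F).

Lemma is_dir_deriv_unique f x h l l' :
  is_dir_deriv f x h l -> is_dir_deriv f x h l' -> l = l'.
Proof. by move=> fl fl'; exact: (@cvg_unique F lcs_hausdorff _ _ _ _ fl fl'). Qed.

Lemma dir_derivE f x h l : is_dir_deriv f x h l -> dir_deriv h f x = l.
Proof.
move=> fl; rewrite /dir_deriv; case: xgetP => [l' _ /= fl'|/(_ l)//].
exact: is_dir_deriv_unique fl' fl.
Qed.

Lemma dir_derivP f x h : dir_derivable f x h -> is_dir_deriv f x h (dir_deriv h f x).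
Proof. by move=> [l fl]; rewrite (dir_derivE fl). Qed.

Lemma near_line O x h : open O -> O x -> \forall t \near (0:R)^', O (x + t *: h).
Proof.
move=> oO Ox.
have : (fun t : R => x + t *: h) @ (0:R)^' --> x + 0 *: h.
  apply: cvg_addr; first exact: cvg_cst.
  apply: cvg_scaler; last exact: cvg_cst.
  exact: nbhs_dnbhs.
rewrite scale0r addr0 => /(_ O); apply; exact: open_nbhs_nbhs.
Qed.

Lemma is_dir_deriv_eq O f g x h l : open O -> O x ->
  (forall z, O z -> f z = g z) -> is_dir_deriv f x h l -> is_dir_deriv g x h l.
Proof.
move=> oO Ox fg fl; apply: cvg_trans fl; apply: near_eq_cvg.
by apply: filterS (near_line h oO Ox) => t Ot; rewrite !fg.
Qed.

Lemma is_dir_deriv_lin f g x h l m (a : R) :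
  is_dir_deriv f x h l -> is_dir_deriv g x h m ->
  is_dir_deriv (a *: f + g) x h (a *: l + m).
Proof.
move=> fl gm; have FF : Filter (0 : R)^' by exact: _.
have L := cvg_lin (k := a) FF fl gm; apply: cvg_trans L; apply: near_eq_cvg.
apply: nearW => t; rewrite !fctE scalerA (mulrC a) -scalerA -scalerDr.
by congr (_ *: _); rewrite scalerBr opprD addrACA.
Qed.

Lemma iter_deriv_eq O hs f g : open O -> (forall z, O z -> f z = g z) ->
  iter_derivable O hs f ->
  iter_derivable O hs g /\ (forall z, O z -> iter_deriv hs f z = iter_deriv hs g z).
Proof.
move=> oO; elim: hs f g => [|h hs IH] f g fg //= [df dhf].
have dg z : O z -> is_dir_deriv g z h (dir_deriv h f z).
  by move=> Oz; apply: is_dir_deriv_eq fg _ => //; exact/dir_derivP/df.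
have E z : O z -> dir_deriv h f z = dir_deriv h g z.
  by move=> Oz; rewrite (dir_derivE (dg _ Oz)).
have [Dg Eg] := IH _ _ E dhf.
by split=> //; split=> // z Oz; exists (dir_deriv h f z); exact: dg.
Qed.

Lemma iter_deriv_lin O hs f g (a : R) : open O ->
  iter_derivable O hs f -> iter_derivable O hs g ->
  iter_derivable O hs (a *: f + g) /\
  (forall z, O z ->
    iter_deriv hs (a *: f + g) z = a *: iter_deriv hs f z + iter_deriv hs g z).
Proof.
move=> oO; elim: hs f g => [|h hs IH] f g //= [df dhf] [dg dhg].
have dl z : O z ->
    is_dir_deriv (a *: f + g) z h (a *: dir_deriv h f z + dir_deriv h g z).
  by move=> Oz; apply: is_dir_deriv_lin; apply/dir_derivP; [exact: df|exact: dg].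
have [dfg Efg] := IH _ _ dhf dhg.
have E0 z : O z ->
    (a *: dir_deriv h f + dir_deriv h g) z = dir_deriv h (a *: f + g) z.
  by move=> Oz; rewrite (dir_derivE (dl _ Oz)).
have [d E] := iter_deriv_eq oO E0 dfg.
split; last by move=> z Oz; rewrite -E// Efg.
by split=> // z Oz; eexists; exact: dl.
Qed.

Lemma cts_deriv_lin (Y : topologicalType) (dirs : Y -> seq G) O f g (a : R) :
  open O -> cts_deriv dirs O f -> cts_deriv dirs O g ->
  cts_deriv dirs O (a *: f + g).
Proof.
move=> oO [df cf] [dg cg]; split=> [y|].
  by have [] := iter_deriv_lin a oO (df y) (dg y).
apply: (@subspace_eq_continuous _ _ _ (fun p : G * Y =>
  a *: iter_deriv (dirs p.2) f p.1 + iter_deriv (dirs p.2) g p.1)).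
  move=> p /set_mem [Op _].
  by have [_ E] := iter_deriv_lin a oO (df p.2) (dg p.2); rewrite /from_subspace E.
by move=> p; apply: cvg_lin; [exact: cf|exact: cg].
Qed.

Lemma iter_deriv0 O hs : open O ->
  iter_derivable O hs (0 : G -> F) /\ (forall z, O z -> iter_deriv hs (0 : G -> F) z = 0).
Proof.
move=> oO.
have d0 x h : is_dir_deriv (0 : G -> F) x h 0.
  rewrite /is_dir_deriv (_ : (fun t : R => _) = cst 0); first exact: cvg_cst.
  by apply/funext => t; rewrite !fctE subrr scaler0.
have E h : dir_deriv h (0 : G -> F) = 0.
  by apply/funext => x; rewrite (dir_derivE (d0 x h)).
elim: hs => //= h hs [IH1 IH2]; rewrite E; split=> //; split=> // x _.
by exists 0.
Qed.

Lemma cts_deriv0 (Y : topologicalType) (dirs : Y -> seq G) O :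
  open O -> cts_deriv dirs O (0 : G -> F).
Proof.
move=> oO; split=> [y|]; first by have [] := iter_deriv0 (dirs y) oO.
apply: (@subspace_eq_continuous _ _ _ (fun p : G * Y => 0)).
  by move=> p /set_mem [Op _]; have [_ E] := iter_deriv0 (dirs p.2) oO; rewrite /from_subspace E.
by move=> p; exact: cvg_cst.
Qed.

End deriv_lemmas.

Section compact_open_tvs.
Context {R : realType} {F : lcsType R}.

Lemma nbhs_translate (W : set F) (a : F) : nbhs 0 W -> nbhs a [set z | W (z - a)].
Proof.
move=> W0; suff : (fun z : F => z + - a) @ a --> a + - a by rewrite subrr; apply.
by apply: cvg_addr; [exact: cvg_id|exact: cvg_cst].
Qed.

Lemma nbhs_translate0 (A : set F) (a : F) : nbhs a A -> nbhs 0 [set w | A (a + w)].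
Proof.
move=> Aa; suff : (fun w : F => a + w) @ (0 : F) --> a + 0 by rewrite addr0; apply.
by apply: cvg_addr; [exact: cvg_cst|exact: cvg_id].
Qed.

Lemma nbhs0_add (W : set F) : nbhs 0 W ->
  exists2 W', nbhs 0 W' & forall a b, W' a -> W' b -> W (a + b).
Proof.
move=> W0; have := @tvs.add_continuous F (0, 0) W; rewrite /= addr0 => /(_ W0).
move=> [[A B] /= [A0 B0] AB]; exists (A `&` B); first exact: filterI.
by move=> a b [Aa _] [_ Bb]; exact: (AB (a, b)).
Qed.

Lemma nbhs0_sub (W : set F) : nbhs 0 W ->
  exists2 W', nbhs 0 W' & forall a b, W' a -> W' b -> W (a - b).
Proof.
move=> W0; have := @tvs.sub_continuous F (0, 0) W; rewrite /= subr0 => /(_ W0).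
move=> [[A B] /= [A0 B0] AB]; exists (A `&` B); first exact: filterI.
by move=> a b [Aa _] [_ Bb]; exact: (AB (a, b)).
Qed.

Lemma compact_open_cvg_subP (X : topologicalType) (f : X -> F)
    (G : set_system {compact-open, X -> F}) :
  Filter G -> continuous f ->
  G --> (f : {compact-open, X -> F}) <->
  forall K W, compact K -> nbhs (0 : F) W ->
    G [set g | forall x, K x -> W (g x - f x)].
Proof.
move=> FG cf; split.
  move=> /compact_open_cvgP H K W cK W0.
  move/compact_near_coveringP/near_covering_withinP : (cK).
  apply=> u Ku.
  have [W1 W10 W1W] := nbhs0_sub W0.
  have nO := nbhs_interior (nbhs_translate (f u) W10).
  have [Q Qu QO] := @uniform_regular F (f u) _ nO.
  have nC : nbhs u (f @^-1` Q) by exact: cf.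
  have GO : G [set g | g @` (K `&` closure (f @^-1` Q)) `<=` [set z | W1 (z - f u)]°].
    apply: H; [|exact: open_interior|].
    - by apply: compact_closedI => //; exact: closed_closure.
    - move=> _ [x [Kx clx] <-]; apply: QO => B Bx.
      by have [y [Qy By]] := clx (f @^-1` B) (cf _ _ Bx); exists (f y).
  exists (f @^-1` Q, [set g | g @` (K `&` closure (f @^-1` Q)) `<=`
      [set z | W1 (z - f u)]°]); first by split.
  move=> [x g] /= [Qx gO] Kx.
  rewrite -[g x - f x](subrKA (f u)) -[f u - f x]opprB.
  apply: W1W.
    have clx : closure (f @^-1` Q) x by exact: subset_closure.
    by have /interior_subset : [set z | W1 (z - f u)]° (g x) by apply: gO; exists x.
  have clx : closure Q (f x) by exact: subset_closure.
  by have /interior_subset := QO _ clx.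
move=> H; apply/compact_open_cvgP => K O cK oO fKO.
pose W := [set w : F | forall x, K x -> O (f x + w)].
have W0 : nbhs (0 : F) W.
  move/compact_near_coveringP/near_covering_withinP : (cK).
  apply=> u Ku.
  have Ou : O (f u) by apply: fKO; exists u.
  have /(_ O) : (fun p : X * F => f p.1 + p.2) @ (u, 0 : F) --> f u + 0.
    apply: cvg_addr; last exact: cvg_snd.
    by apply: (@cvg_comp _ _ _ fst f _ (nbhs u)); [exact: cvg_fst|exact: cf].
  rewrite addr0 => /(_ (open_nbhs_nbhs (conj oO Ou))) [[A B] /= [Au B0] AB].
  by exists (A, B) => // -[x w] /= [Ax Bw] Kx; exact: (AB (x, w)).
apply: filterS (H K W cK W0) => g Wg _ [x Kx <-].
by have := Wg x Kx x Kx; rewrite addrC subrK.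
Qed.

End compact_open_tvs.

(* A topology on a vector space M that is initial for linear maps
   L i : M -> C(X i, F) into spaces of continuous maps with values in a locally
   convex space makes M a locally convex space, if the maps separate points. *)
Section initial_lcs.
Context {R : realType} {F : lcsType R}.
Context {M : preTopologicalLmodType R} {I : Type} {X : I -> topologicalType}.
Variable L : forall i, M -> {compact-open, X i -> F}.
Arguments L : clear implicits.
Hypothesis Lcont : forall i f, continuous (L i f : X i -> F).
Hypothesis Llin : forall i (a : R) f g x,
  (L i (a *: f + g) : X i -> F) x = a *: (L i f : X i -> F) x + (L i g : X i -> F) x.
Hypothesis Lsep : forall f g,
  (forall i x, (L i f : X i -> F) x = (L i g : X i -> F) x) -> f = g.
Hypothesis Lcvg : forall (f : M) (G : set_system M), Filter G ->
  G --> f <-> forall i, L i @ G --> L i f.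

Local Notation LL i f x := ((@L i f : X i -> F) x).

Lemma initial_lcs_cvgP (f : M) (T : Type) (h : T -> M) (G : set_system T) : Filter G ->
  h @ G --> f <-> forall i (K : set (X i)) W, compact K -> nbhs (0 : F) W ->
    \forall t \near G, forall x, K x -> W (LL i (h t) x - LL i f x).
Proof.
move=> FG; rewrite Lcvg; split=> H i.
  by have /(compact_open_cvg_subP _ (@Lcont i f)) := H i.
by apply/(compact_open_cvg_subP _ (@Lcont i f)); exact: H.
Qed.

Lemma LD i f g x : LL i (f + g) x = LL i f x + LL i g x.
Proof. by have := @Llin i 1 f g x; rewrite !scale1r. Qed.

Lemma L0 i x : LL i 0 x = 0.
Proof. by have /eqP := @LD i 0 0 x; rewrite addr0 -subr_eq subrr => /eqP. Qed.

Lemma LZ i a f x : LL i (a *: f) x = a *: LL i f x.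
Proof. by have := @Llin i a f 0 x; rewrite L0 !addr0. Qed.

Lemma LB i f g x : LL i (f - g) x = LL i f x - LL i g x.
Proof. by rewrite LD -scaleN1r LZ scaleN1r. Qed.

Lemma initial_lcs_add : continuous (fun p : M * M => p.1 + p.2).
Proof.
move=> [f g]; apply/initial_lcs_cvgP => i K W cK W0.
have [W' W'0 W'W] := nbhs0_add W0.
have idP (h : M) : \forall t \near h, forall x, K x -> W' (LL i t x - LL i h x).
  by have /initial_lcs_cvgP := @cvg_id _ (nbhs h); apply.
exists ([set t | forall x, K x -> W' (LL i t x - LL i f x)],
        [set t | forall x, K x -> W' (LL i t x - LL i g x)]).
  by split; exact: idP.
move=> [f' g'] /= [Hf Hg] x Kx.
by rewrite !LD opprD addrACA; apply: W'W; [exact: Hf|exact: Hg].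
Qed.

Lemma initial_lcs_scale : continuous (fun p : R^o * M => p.1 *: p.2).
Proof.
move=> [a f]; apply/initial_lcs_cvgP => i K W cK W0.
have [W' W'0 W'W] := nbhs0_add W0.
have [[A B] /= [A1 B1] AB] : nbhs (a : R^o, 0 : F) [set p : R^o * F | W' (p.1 *: p.2)].
  have := @tvs.scale_continuous R F (a, 0) W'; rewrite /= scaler0; exact.
have NA : \forall b \near (a : R^o), forall x, K x -> W' ((b - a) *: LL i f x).
  have FA : Filter (nbhs (a : R^o)) by exact: nbhs_filter.
  move/compact_near_coveringP/near_covering_withinP : (cK) => /(_ R^o (nbhs (a : R^o))
    (fun b x => W' ((b - a) *: LL i f x)) FA) NC.
  apply: NC => u Ku.
  have cXF : (fun p : X i * R^o => LL i f p.1) @ (u, a : R^o) --> LL i f u.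
    apply: (@cvg_comp _ _ _ fst (L i f : X i -> F) _ (nbhs u)); first exact: cvg_fst.
    exact: Lcont.
  have cR : (fun p : X i * R^o => p.2 - a : R) @ (u, a : R^o) --> (a - a : R).
    by apply: (@cvg_addr R R^o); [exact: cvg_snd|exact: cvg_cst].
  have /(_ W') := cvg_scaler (nbhs_filter _) cR cXF.
  rewrite subrr scale0r => /(_ W'0) [[A' B'] /= [Au' B0'] AB'].
  by exists (A', B') => // -[x w] /= [Ax Bw] Kx; exact: (AB' (x, w)).
have NB : \forall g \near f, forall x, K x -> B (LL i g x - LL i f x).
  by have /initial_lcs_cvgP := @cvg_id _ (nbhs f); apply.
exists (A `&` [set b | forall x, K x -> W' ((b - a) *: LL i f x)],
        [set g | forall x, K x -> B (LL i g x - LL i f x)]).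
  by split => //; exact: filterI.
move=> [b g] /= [[Ab Hb] Hg] x Kx; rewrite !LZ.
rewrite (_ : _ - _ = b *: (LL i g x - LL i f x) + (b - a) *: LL i f x); last first.
  by rewrite scalerBr scalerBl addrA subrK.
by apply: W'W; [apply: (AB (b, _)); split=> //; exact: Hg|exact: Hb].
Qed.

Local Open Scope convex_scope.

Lemma convexI (E : lmodType R) (A B : set E) :
  convex_set A -> convex_set B -> convex_set (A `&` B).
Proof.
move=> cA cB x y l /[!inE] -[Ax Bx] [Ay By]; split.
  by apply/set_mem/cA; rewrite inE.
by apply/set_mem/cB; rewrite inE.
Qed.

Lemma initial_lcs_interior_convex (A : set M) : convex_set A -> convex_set A°.
Proof.
move=> cA; apply/convex_setW => x y /set_mem Ax /set_mem Ay k k0 k1.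
apply/mem_set.
pose h (z : M) := (k%:num^-1 *: (z - (1 - k%:num) *: y) : M).
pose p := (k%:num *: x + (1 - k%:num) *: y : M).
have hp : h p = x by rewrite /h /p addrK scalerA mulVf ?scale1r// gt_eqF.
have hz z : k%:num *: h z + (1 - k%:num) *: y = z.
  by rewrite /h scalerA mulfV ?scale1r ?subrK// gt_eqF.
have ch : h @ p --> h p.
  pose sub (z : M) := (z - (1 - k%:num) *: y : M).
  have c1 : sub @ p --> sub p.
    apply: (@cvg_comp _ _ _ (fun z : M => (z, - ((1 - k%:num) *: y) : M))
      (fun q : M * M => q.1 + q.2) (nbhs p) (nbhs (p, - ((1 - k%:num) *: y) : M))).
      by apply: cvg_pair; [exact: cvg_id|exact: cvg_cst].
    exact: (@initial_lcs_add (p, - ((1 - k%:num) *: y))).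
  apply: (@cvg_comp _ _ _ (fun z : M => (k%:num^-1 : R^o, sub z))
      (fun q : R^o * M => q.1 *: q.2) (nbhs p) (nbhs (k%:num^-1 : R^o, sub p))).
    apply: (@cvg_pair _ _ _ (nbhs p) (nbhs (k%:num^-1 : R^o)) (nbhs (sub p))) => //.
    exact: cvg_cst.
  exact: (@initial_lcs_scale (k%:num^-1 : R^o, sub p)).
have : nbhs p (h @^-1` A) by apply: ch; rewrite hp.
apply: filterS => z /= Ahz; rewrite -(hz z).
by apply/set_mem/(cA (h z) y k); apply/mem_set => //; exact: interior_subset.
Qed.

Lemma convex_nbhs0 (W : set F) : nbhs 0 W ->
  exists C : set F, [/\ nbhs 0 C, convex_set C & C `<=` W].
Proof.
move=> W0; have [B cB [Bo Bb]] := @locally_convex R F.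
have [C [BC C0] CW] := Bb 0 W W0; exists C; split=> //.
  by apply: open_nbhs_nbhs; split=> //; exact: Bo.
by apply: cB; rewrite inE.
Qed.

Lemma initial_lcs_convex_nbhs (f : M) (A : set M) : nbhs f A ->
  exists C : set M, [/\ nbhs f C, convex_set C & C `<=` A].
Proof.
pose Q : set_system M :=
  [set A | exists C : set M, [/\ nbhs f C, convex_set C & C `<=` A]].
have FQ : Filter Q.
  split.
  - exists setT; split; [exact: filterT|by move=> x y l _ _; rewrite inE|by []].
  - move=> P1 P2 [C1 [n1 c1 s1]] [C2 [n2 c2 s2]]; exists (C1 `&` C2); split.
    + exact: filterI.
    + exact: convexI.
    + exact: setISS.
  - by move=> P1 P2 P12 [C [n c s]]; exists C; split=> //; exact: subset_trans P12.
suff : (fun x : M => x) @ Q --> f by apply.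
apply/initial_lcs_cvgP => i K W cK W0.
have [C [C0 cC CW]] := convex_nbhs0 W0.
exists [set g | forall x, K x -> C (LL i g x - LL i f x)]; split.
- by have /initial_lcs_cvgP := @cvg_id _ (nbhs f); apply.
- move=> g h l /[!inE] Hg Hh x Kx.
  have cE : LL i (l%:num *: (g : M) + (1 - l%:num) *: (h : M)) x - LL i f x =
      l%:num *: (LL i g x - LL i f x) + (1 - l%:num) *: (LL i h x - LL i f x).
    rewrite Llin LZ !scalerBr addrACA -opprD -scalerDl.
    by rewrite [_ + (1 - _)]addrC subrK scale1r.
  change (C (LL i (l%:num *: (g : M) + (1 - l%:num) *: (h : M)) x - LL i f x)).
  rewrite cE.
  apply/set_mem/(cC (LL i g x - LL i f x) (LL i h x - LL i f x) l).
    by apply/mem_set/Hg.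
  by apply/mem_set/Hh.
- by move=> g Hg x Kx; exact/CW/Hg.
Qed.

Lemma initial_lcs_locally_convex :
  exists2 B : set_system M, (forall b, b \in B -> convex_set b) & basis B.
Proof.
exists [set C | open C /\ convex_set C]; first by move=> C /[!inE] -[].
split; first by move=> C [].
move=> f A /initial_lcs_convex_nbhs[C [Cf cC CA]].
exists C° => /=; last by apply: subset_trans CA; exact: interior_subset.
by split=> //; split; [exact: open_interior|exact: initial_lcs_interior_convex].
Qed.

Lemma initial_lcs_hausdorff : hausdorff_space M.
Proof.
move=> f g fg; apply: Lsep => i x; have hF : hausdorff_space F := lcs_hausdorff.
apply: hF => A B Af Bg.
have ev (h : M) (D : set F) : nbhs (LL i h x) D -> nbhs h [set t | D (LL i t x)].
  move=> /nbhs_translate0 D0.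
  have /initial_lcs_cvgP H := @cvg_id _ (nbhs h).
  apply: filterS (H i [set x] _ (@compact_set1 _ x) D0) => t /(_ x erefl) /=.
  by rewrite addrC subrK.
have [h [Ah Bh]] := fg _ _ (ev _ _ Af) (ev _ _ Bg).
by exists (LL i h x).
Qed.

End initial_lcs.

Lemma initial_cvgP (S : choiceType) (T : topologicalType) (h : S -> T)
    (G : set_system S) (f : S) : Filter G ->
  G --> (f : initial_topology h) <-> h @ G --> h f.
Proof.
move=> FG; split.
  by move=> Gf A /(@initial_continuous _ _ h f) hA; exact: Gf.
move=> Gf A; rewrite nbhsE => -[_ [[B oB <-] Bf BA]].
by apply: filterS BA _; apply: Gf; exact: open_nbhs_nbhs.
Qed.

(* X is the domain, embedded by [incl] in the vector space G, O is its interior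
   and phi is any map on G that represents f on O.  The last clause is the
   convention d^(0) f = f (on all of X). *)
Definition deriv_ext {R : realType} {G : tvsType R} {F : lcsType R}
    {X Y : topologicalType} (dirs : Y -> seq G) (O : set G) (incl : X -> G)
    (phi : G -> F) (f : X -> F) (g : X * Y -> F) :=
  [/\ continuous g,
      forall x y, O (incl x) -> g (x, y) = iter_deriv (dirs y) phi (incl x) &
      forall x y, dirs y = [::] -> g (x, y) = f x].

Section deriv_ext_lemmas.
Context {R : realType} {G : tvsType R} {F : lcsType R} {X Y : topologicalType}.
Variables (dirs : Y -> seq G) (O : set G) (incl : X -> G).
Hypothesis oO : open O.
Implicit Types (phi psi : G -> F) (f : X -> F) (g : X * Y -> F).

Lemma deriv_ext_lin phi psi f1 f2 g1 g2 (a : R) :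
  cts_deriv dirs O phi -> cts_deriv dirs O psi ->
  deriv_ext dirs O incl phi f1 g1 -> deriv_ext dirs O incl psi f2 g2 ->
  deriv_ext dirs O incl (a *: phi + psi) (a *: f1 + f2) (a *: g1 + g2).
Proof.
move=> [d1 _] [d2 _] [c1 e1 z1] [c2 e2 z2]; split.
- by move=> p; apply: cvg_lin; [exact: c1|exact: c2].
- move=> x y Ox; have [_ ->//] := iter_deriv_lin a oO (d1 y) (d2 y).
  by rewrite -e1// -e2.
- by move=> x y y0; rewrite !fctE z1// z2.
Qed.

Lemma deriv_ext0 : deriv_ext dirs O incl (0 : G -> F) 0 0.
Proof.
split=> //; first by move=> p; exact: cvg_cst.
by move=> x y Ox; have [_ ->] := iter_deriv0 (F := F) (dirs y) oO.
Qed.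

Hypothesis dO : closure [set x | O (incl x)] = setT.

Lemma deriv_ext_unique phi f g1 g2 :
  deriv_ext dirs O incl phi f g1 -> deriv_ext dirs O incl phi f g2 -> g1 = g2.
Proof.
move=> [c1 e1 _] [c2 e2 _]; apply/funext => -[x y].
have hF : hausdorff_space F := lcs_hausdorff.
apply: hF => A B /c1 Ag /c2 Bg.
have [[P Q] /= [Px Qy] PQ] : nbhs (x, y) (g1 @^-1` A `&` g2 @^-1` B).
  by apply: filterI; [exact: Ag|exact: Bg].
have : closure [set x | O (incl x)] x by rewrite dO.
move=> /(_ P Px) [z [Oz Pz]].
have [Az Bz] := PQ (z, y) (conj Pz (nbhs_singleton Qy)).
by exists (g1 (z, y)); split=> //; rewrite e1// -e2.
Qed.

Definition the_deriv_ext phi f : {compact-open, (X * Y)%type -> F} :=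
  xget ((fun=> 0) : {compact-open, (X * Y)%type -> F}) [set g | deriv_ext dirs O incl phi f g].

Lemma the_deriv_extP phi f : (exists g, deriv_ext dirs O incl phi f g) ->
  deriv_ext dirs O incl phi f (the_deriv_ext phi f).
Proof. by move=> [g fg]; rewrite /the_deriv_ext; case: xgetP => // /(_ g). Qed.

Lemma the_deriv_extE phi f g : deriv_ext dirs O incl phi f g ->
  the_deriv_ext phi f = g.
Proof.
move=> fg; exact: (deriv_ext_unique (the_deriv_extP (ex_intro _ g fg)) fg).
Qed.

End deriv_ext_lemmas.

Notation cartesian_power E k := (prod_topology (fun _ : 'I_k => E)).

Section Cr.
Context {R : realType} {E : lcsType R}.
Variables (r : option nat) (U : lcsubset E) (F : lcsType R).

(* Extension by 0; derivatives are only taken on the interior of U, where the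
   choice of the extension does not matter. *)
Definition Cr_ext0 (f : U -> F) : E -> F := 'valL_0 f.

Definition Cr_dirs k (y : cartesian_power E k) : seq E := [seq y i | i : 'I_k].

Definition Cr (f : U -> F) : Prop := forall k, order_le k r ->
  cts_deriv (@Cr_dirs k) U° (Cr_ext0 f) /\
  exists g, deriv_ext (@Cr_dirs k) U° set_val (Cr_ext0 f) f g.

Definition Cr_pred : {pred U -> F} := mem [set f | Cr f].

Record Crmap := MkCrmap { crfun :> U -> F; crfunP : crfun \in Cr_pred }.

HB.instance Definition _ := [isSub for crfun].
HB.instance Definition _ := [Choice of Crmap by <:].

(* d^(k) : C^r(U, F) -> C(U x E^k, F).  Its values are continuous maps; the
   compact-open topology of C(U x E^k, F) is induced by the one on all maps. *)
Definition Cr_d (k : {k | order_le k r}) (f : Crmap) :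
    {compact-open, (U * cartesian_power E (sval k))%type -> F} :=
  the_deriv_ext (@Cr_dirs (sval k)) U° set_val (Cr_ext0 f) f.

Lemma Cr_ext0_lin (a : R) (f g : U -> F) :
  Cr_ext0 (a *: f + g) = a *: Cr_ext0 f + Cr_ext0 g.
Proof.
apply/funext => x; rewrite /Cr_ext0 /valL_ !fctE/=.
by case: ('oinv_set_val x) => //=; rewrite scaler0 addr0.
Qed.

Lemma Cr_ext00 : Cr_ext0 0 = 0.
Proof. by apply/funext => x; rewrite /Cr_ext0 /valL_ !fctE/=; case: ('oinv_set_val x). Qed.

Lemma CrP (f : Crmap) : Cr f. Proof. by have /set_mem := crfunP f. Qed.

Lemma Cr_submod_closed : submod_closed Cr_pred.
Proof.
split=> [|a f g /set_mem/= Cf /set_mem/= Cg]; apply/mem_set => k kr.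
  rewrite Cr_ext00; split; first exact/cts_deriv0/open_interior.
  by exists 0; exact/deriv_ext0/open_interior.
rewrite Cr_ext0_lin; have [df [f' ff']] := Cf k kr; have [dg [g' gg']] := Cg k kr.
split; first by apply: cts_deriv_lin => //; exact: open_interior.
by exists (a *: f' + g'); apply: deriv_ext_lin => //; exact: open_interior.
Qed.

HB.instance Definition _ := GRing.isSubmodClosed.Build _ _ Cr_pred Cr_submod_closed.
HB.instance Definition _ := [SubChoice_isSubLmodule of Crmap by <:].

HB.instance Definition _ := Topological.copy Crmap
  (sup_topology (fun k => Topological.class (initial_topology (@Cr_d k)))).


Lemma Cr_cvg (f : Crmap) (G : set_system Crmap) : Filter G ->
  G --> f <-> forall k, @Cr_d k @ G --> @Cr_d k f.
Proof.
move=> FG; split=> [/cvg_sup H k|H].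
  exact/(@initial_cvgP _ _ (@Cr_d k))/H.
by apply/cvg_sup => k; apply/(@initial_cvgP _ _ (@Cr_d k)); exact: H.
Qed.

Lemma Cr_dense : closure [set x : U | U° (set_val x)] = setT.
Proof.
apply/seteqP; split=> // -[x xU] _ P [_ [[B oB <-] /= Bx BP]].
have Ux : lcsubset_set U x by exact: set_mem.
have [z [Uz Bz]] := lcsubset_dense Ux (open_nbhs_nbhs (conj oB Bx)).
have Uz' : z \in lcsubset_set U by apply/mem_set; exact: interior_subset.
by exists (exist _ z Uz'); split=> //; apply: BP.
Qed.

Lemma Cr_dP k (f : Crmap) :
  deriv_ext (@Cr_dirs (sval k)) U° set_val (Cr_ext0 f) f (@Cr_d k f).
Proof. by apply: the_deriv_extP; have [_] := CrP f (svalP k). Qed.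

Lemma Cr_d_continuous k (f : Crmap) :
  continuous (@Cr_d k f : U * cartesian_power E (sval k) -> F).
Proof. by have [] := Cr_dP k f. Qed.

Lemma Cr_d_lin k (a : R) (f g : Crmap) p :
  (@Cr_d k (a *: f + g) : U * cartesian_power E (sval k) -> F) p =
  a *: (@Cr_d k f : U * cartesian_power E (sval k) -> F) p +
  (@Cr_d k g : U * cartesian_power E (sval k) -> F) p.
Proof.
have [df _] := CrP f (svalP k); have [dg _] := CrP g (svalP k).
have L := deriv_ext_lin (@open_interior _ _) a df dg (Cr_dP k f) (Cr_dP k g).
have H : Cr_ext0 (a *: f + g : Crmap) = a *: Cr_ext0 f + Cr_ext0 g.
  exact: Cr_ext0_lin.
rewrite -H in L.
by rewrite /Cr_d (the_deriv_extE Cr_dense L).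
Qed.

Lemma Cr_d_separates (f g : Crmap) :
  (forall k p, (@Cr_d k f : U * cartesian_power E (sval k) -> F) p =
     (@Cr_d k g : U * cartesian_power E (sval k) -> F) p) -> f = g.
Proof.
move=> fg; apply/val_inj/funext => x /=.
have r0 : order_le 0 r by case: r.
pose k : {k | order_le k r} := exist _ 0%N r0.
pose y : cartesian_power E 0 := fun=> 0.
have y0 : Cr_dirs y = [::] by apply: size0nil; rewrite size_map -cardE card_ord.
have [_ _ Ef] := Cr_dP k f; have [_ _ Eg] := Cr_dP k g.
rewrite -(Ef x y y0) -(Eg x y y0).
exact: (fg k (x, y)).
Qed.

HB.instance Definition _ :=
  PreTopologicalNmodule_isTopologicalNmodule.Build Crmap
    (initial_lcs_add Cr_d_continuous Cr_d_lin Cr_cvg).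
HB.instance Definition _ :=
  TopologicalNmodule_isTopologicalLmodule.Build R Crmap
    (initial_lcs_scale Cr_d_continuous Cr_d_lin Cr_cvg).
HB.instance Definition _ := PreTopologicalLmod_isTvs.Build R Crmap
  (initial_lcs_add Cr_d_continuous Cr_d_lin Cr_cvg)
  (initial_lcs_scale Cr_d_continuous Cr_d_lin Cr_cvg)
  (initial_lcs_locally_convex Cr_d_continuous Cr_d_lin Cr_cvg).
HB.instance Definition _ := Uniform_isTvs.Build R Crmap
  (initial_lcs_locally_convex Cr_d_continuous Cr_d_lin Cr_cvg).

HB.instance Definition _ := isHausdorff.Build Crmap
  (initial_lcs_hausdorff Cr_d_continuous Cr_d_separates Cr_cvg).

End Cr.

Section Crs.
Context {R : realType} {E1 E2 : lcsType R}.
Variables (r s : option nat) (U : lcsubset E1) (V : lcsubset E2) (F : lcsType R).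

(* extension by 0, as in [Cr_ext0] *)
Definition Crs_ext0 (f : U * V -> F) : E1 * E2 -> F :=
  'valL_0 (f \o @setX_of_sigT E1 E2 U V).

(* (0, v_1), ..., (0, v_j), (w_1, 0), ..., (w_i, 0): the V-derivatives come first *)
Definition Crs_dirs i j (p : cartesian_power E1 i * cartesian_power E2 j) :
    seq (E1 * E2) :=
  [seq (0, p.2 l) | l : 'I_j] ++ [seq (p.1 l, 0) | l : 'I_i].

(* (U x V)° = U° x V° *)
Definition Crs_interior : set (E1 * E2) := U° `*` V°.

Definition Crs_incl (p : U * V) : E1 * E2 := (set_val p.1, set_val p.2).

Definition Crs (f : U * V -> F) : Prop :=
  forall i j, order_le i r -> order_le j s ->
    cts_deriv (@Crs_dirs i j) Crs_interior (Crs_ext0 f) /\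
    exists g, deriv_ext (@Crs_dirs i j) Crs_interior Crs_incl (Crs_ext0 f) f g.

Definition Crs_pred : {pred U * V -> F} := mem [set f | Crs f].

Record Crsmap := MkCrsmap { crsfun :> U * V -> F; crsfunP : crsfun \in Crs_pred }.

HB.instance Definition _ := [isSub for crsfun].
HB.instance Definition _ := [Choice of Crsmap by <:].

(* d^(i,j) : C^{r,s}(U x V, F) -> C(U x V x E1^i x E2^j, F) *)
Definition Crs_d (ij : {ij : nat * nat | order_le ij.1 r && order_le ij.2 s})
    (f : Crsmap) :
    {compact-open, (U * V *
      (cartesian_power E1 (sval ij).1 * cartesian_power E2 (sval ij).2))%type -> F} :=
  the_deriv_ext (@Crs_dirs (sval ij).1 (sval ij).2) Crs_interior Crs_incl
    (Crs_ext0 f) f.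

Lemma open_Crs_interior : open Crs_interior.
Proof.
rewrite openE => -[x y] [/= Ux Vy]; exists (U°, V°) => //=; split;
by apply: open_nbhs_nbhs; split=> //; exact: open_interior.
Qed.

Lemma Crs_ext0_lin (a : R) (f g : U * V -> F) :
  Crs_ext0 (a *: f + g) = a *: Crs_ext0 f + Crs_ext0 g.
Proof.
apply/funext => x; rewrite /Crs_ext0 /valL_ !fctE/=.
by case: ('oinv_set_val x) => //=; rewrite scaler0 addr0.
Qed.

Lemma Crs_ext00 : Crs_ext0 0 = 0.
Proof.
by apply/funext => x; rewrite /Crs_ext0 /valL_ !fctE/=; case: ('oinv_set_val x).
Qed.

Lemma CrsP (f : Crsmap) : Crs f. Proof. by have /set_mem := crsfunP f. Qed.

Lemma Crs_submod_closed : submod_closed Crs_pred.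
Proof.
have oO := open_Crs_interior.
split=> [|a f g /set_mem/= Cf /set_mem/= Cg]; apply/mem_set => i j ir js.
  rewrite Crs_ext00; split; first exact/cts_deriv0.
  by exists 0; exact/deriv_ext0.
rewrite Crs_ext0_lin.
have [df [f' ff']] := Cf i j ir js; have [dg [g' gg']] := Cg i j ir js.
split; first exact: cts_deriv_lin.
by exists (a *: f' + g'); exact: deriv_ext_lin.
Qed.

HB.instance Definition _ := GRing.isSubmodClosed.Build _ _ Crs_pred Crs_submod_closed.
HB.instance Definition _ := [SubChoice_isSubLmodule of Crsmap by <:].

HB.instance Definition _ := Topological.copy Crsmap
  (sup_topology (fun ij => Topological.class (initial_topology (@Crs_d ij)))).

Lemma Crs_cvg (f : Crsmap) (G : set_system Crsmap) : Filter G ->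
  G --> f <-> forall k, @Crs_d k @ G --> @Crs_d k f.
Proof.
move=> FG; split=> [/cvg_sup H k|H].
  exact/(@initial_cvgP _ _ (@Crs_d k))/H.
by apply/cvg_sup => k; apply/(@initial_cvgP _ _ (@Crs_d k)); exact: H.
Qed.

Lemma Crs_dense : closure [set p | Crs_interior (Crs_incl p)] = setT.
Proof.
apply/seteqP; split=> // -[x y] _ P [[A B] /= [Ax By] AB].
have : closure [set x : U | U° (set_val x)] x by rewrite Cr_dense.
move=> /(_ A Ax) [x' [Ux' Ax']].
have : closure [set x : V | V° (set_val x)] y by rewrite Cr_dense.
move=> /(_ B By) [y' [Vy' By']].
by exists (x', y'); split=> //; exact: (AB (x', y')).
Qed.

Lemma Crs_dP k (f : Crsmap) :
  deriv_ext (@Crs_dirs (sval k).1 (sval k).2) Crs_interior Crs_incl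
    (Crs_ext0 f) f (@Crs_d k f).
Proof.
apply: the_deriv_extP; have /andP[kr ks] := svalP k.
by have [_] := CrsP f kr ks.
Qed.

Let D (k : {ij : nat * nat | order_le ij.1 r && order_le ij.2 s}) : Type :=
  (U * V * (cartesian_power E1 (sval k).1 * cartesian_power E2 (sval k).2))%type.

Lemma Crs_d_continuous k (f : Crsmap) : continuous (@Crs_d k f : D k -> F).
Proof. by have [] := Crs_dP k f. Qed.

Lemma Crs_d_lin k (a : R) (f g : Crsmap) p :
  (@Crs_d k (a *: f + g) : D k -> F) p =
  a *: (@Crs_d k f : D k -> F) p + (@Crs_d k g : D k -> F) p.
Proof.
have /andP[kr ks] := svalP k.
have [df _] := CrsP f kr ks; have [dg _] := CrsP g kr ks.
have L := deriv_ext_lin open_Crs_interior a df dg (Crs_dP k f) (Crs_dP k g).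
have H : Crs_ext0 (a *: f + g : Crsmap) = a *: Crs_ext0 f + Crs_ext0 g.
  exact: Crs_ext0_lin.
rewrite -H in L.
by rewrite /Crs_d (the_deriv_extE Crs_dense L).
Qed.

Lemma Crs_d_separates (f g : Crsmap) :
  (forall k p, (@Crs_d k f : D k -> F) p = (@Crs_d k g : D k -> F) p) -> f = g.
Proof.
move=> fg; apply/val_inj/funext => x /=.
have rs0 : order_le (0, 0)%N.1 r && order_le (0, 0)%N.2 s by case: r; case: s.
pose k : {ij : nat * nat | order_le ij.1 r && order_le ij.2 s} :=
  exist _ (0, 0)%N rs0.
pose y : cartesian_power E1 0 * cartesian_power E2 0 := (fun=> 0, fun=> 0).
have y0 : Crs_dirs y = [::].
  by apply: size0nil; rewrite size_cat !size_image !card_ord.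
have [_ _ Ef] := Crs_dP k f; have [_ _ Eg] := Crs_dP k g.
rewrite -(Ef x y y0) -(Eg x y y0).
exact: (fg k (x, y)).
Qed.

HB.instance Definition _ :=
  PreTopologicalNmodule_isTopologicalNmodule.Build Crsmap
    (initial_lcs_add Crs_d_continuous Crs_d_lin Crs_cvg).
HB.instance Definition _ :=
  TopologicalNmodule_isTopologicalLmodule.Build R Crsmap
    (initial_lcs_scale Crs_d_continuous Crs_d_lin Crs_cvg).
HB.instance Definition _ := PreTopologicalLmod_isTvs.Build R Crsmap
  (initial_lcs_add Crs_d_continuous Crs_d_lin Crs_cvg)
  (initial_lcs_scale Crs_d_continuous Crs_d_lin Crs_cvg)
  (initial_lcs_locally_convex Crs_d_continuous Crs_d_lin Crs_cvg).
HB.instance Definition _ := Uniform_isTvs.Build R Crsmap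
  (initial_lcs_locally_convex Crs_d_continuous Crs_d_lin Crs_cvg).

HB.instance Definition _ := isHausdorff.Build Crsmap
  (initial_lcs_hausdorff Crs_d_continuous Crs_d_separates Crs_cvg).

End Crs.

Definition k_space (X : topologicalType) : Prop :=
  hausdorff_space X /\
  forall A : set X,
    open A <-> forall K : set X, compact K -> open (set_val @^-1` A : set K).

Definition tvs_isomorphism (R : realType) (M N : tvsType R) (Phi : M -> N) : Prop :=
  [/\ linear Phi, continuous Phi &
      exists Psi : N -> M, [/\ cancel Phi Psi, cancel Psi Phi & continuous Psi]].

(* Main.v *)
Require Import Defs.
From HB Require Import structures.
From mathcomp Require Import all_boot all_order all_algebra.
From mathcomp Require Import all_classical all_reals topology tvs.
From mathcomp Require Import convex interval_inference.
Import Order.TTheory GRing.Theory Num.Theory.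
Import numFieldTopology.Exports.

Set Implicit Arguments.
Unset Strict Implicit.
Unset Printing Implicit Defensive.

Local Open Scope classical_set_scope.
Local Open Scope ring_scope.

(** A C^{r,s}-map f on U x V and the map f^vee carry the same derivatives: the
    functions d^(k,j) f on U x V x E1^k x E2^j, read in the second case as maps
    from U x E1^k to functions on V x E2^j.  The theorem says that both readings
    have the same smoothness and the same topology.

    The analysis rests on one estimate, [mean_value]: a difference quotient of a
    curve lies in every convex set that is a neighbourhood of all its
    derivatives.  Its filter form [slopes_cvg] converts convergence of
    derivatives into convergence of difference quotients, uniformly in
    parameters.  It follows that C^s-maps are closed under locally uniform
    convergence of all jets ([Cr_closed]), that difference quotients in x of
    d^(k,j) f converge locally uniformly in the other variables, up to the
    boundary of V ([partial_difference_quotient]), and that directional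
    derivatives commute and are additive ([dir_derivC], [dir_derivD]).

    From f to f^vee.  By induction on k the map y |-> d^(k,0) f (x, y, w) is C^s
    with jets d^(k,j) f (x, -, w, -) ([partial_deriv_smooth]): it is a limit of
    difference quotients when x is an interior point, and a limit of such maps
    when x lies on the boundary.  These maps are the jets of f^vee
    ([vee_smooth]).  Every compact subset of a product lies in a product of
    compact sets, so uniform convergence of d^(k,j) f on compact sets means the
    same in both readings ([Vee_cvg]); the map Phi is a homeomorphism onto its
    image.

    From g to g^wedge.  Evaluating a jet at a point is continuous and linear on
    C^s(V, F), so g^wedge has the iterated derivatives
    d^(j) (d^(i) g (x, w)) (y, v) in the interior, and only the continuity of
    this expression in (x, y, w, v) is at stake ([wedge_smooth]).  A continuous
    map into C^s(V, F) can be evaluated continuously at a moving point that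
    stays in a compact set ([eval_near_compact]).  This is enough if V is
    locally compact, since V x E2^j is then locally compact too, and for maps on
    a k-space.  The k-spaces of the hypotheses have at most one factor E1 and
    one factor E2, hence they control the expression when all entries of w are
    equal and all entries of v are equal.  The expression is symmetric and
    additive in w and in v, so polarization recovers it from these values
    ([Cr_polarization], [wedge_jet_diagonal]). *)

(** * Filters, products and dense subsets *)

Lemma cvg_near (S T : Type) (F : set_system S) (G : set_system T) (f : S -> T) (A : set T) :
  f @ F --> G -> G A -> \forall s \near F, A (f s).
Proof. exact. Qed.

Lemma filter_prod_sub (S T : Type) (F F' : set_system S) (G G' : set_system T) :
  F --> F' -> G --> G' -> filter_prod F G --> filter_prod F' G'.
Proof. by move=> FF GG A [[P Q] [/= /FF ? /GG ?] PQ]; exists (P, Q). Qed.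

Lemma filter_prod_swap (S T : Type) (F : set_system S) (G : set_system T) :
  (fun p => (p.2, p.1)) @ filter_prod F G --> filter_prod G F.
Proof.
by move=> A [[P Q] [/= ? ?] PQ]; exists (Q, P) => // -[s t] /= [? ?]; exact: (PQ (t, s)).
Qed.

Lemma filter_prod_mapl (S S' T : Type) (F : set_system S) (F' : set_system S')
    (G : set_system T) (f : S -> S') : f @ F --> F' ->
  (fun p => (f p.1, p.2)) @ filter_prod F G --> filter_prod F' G.
Proof.
move=> fF A [[P Q] /= [F'P GQ] PQ]; exists (f @^-1` P, Q); first by split=> //; exact: fF.
by move=> [s t] /= [Ps Qt]; exact: (PQ (f s, t)).
Qed.

Lemma within_proper (X : topologicalType) (D : set X) (x : X) : closure D = setT ->
  ProperFilter (within D (nbhs x)).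
Proof.
move=> dD; apply: Build_ProperFilter => W0; have : closure D x by rewrite dD.
by move=> /(_ _ W0)[z [Dz /(_ Dz)]].
Qed.

Lemma closure_fst (X Y : topologicalType) (D : set X) : closure D = setT ->
  closure [set p : X * Y | D p.1] = setT.
Proof.
move=> dD; apply/seteqP; split=> // -[x y] _ A [[P Q] /= [Px /nbhs_singleton Qy] PQ].
have : closure D x by rewrite dD.
by move=> /(_ P Px)[z [Dz Pz]]; exists (z, y); split=> //; exact: (PQ (z, y)).
Qed.

Lemma dense_eq (R : realType) (F : lcsType R) (X : topologicalType) (D : set X) (f g : X -> F) :
  closure D = setT -> continuous f -> continuous g -> (forall x, D x -> f x = g x) -> f = g.
Proof.
move=> dD cf cg fg; apply/funext => x; have hF : hausdorff_space F := lcs_hausdorff.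
apply: hF => A B /cf Ax /cg Bx; have : closure D x by rewrite dD.
have AB : nbhs x (f @^-1` A `&` g @^-1` B) by apply: filterI; [exact: Ax|exact: Bx].
move=> /(_ _ AB)[z [Dz [Az Bz]]]; exists (f z); split=> //.
by rewrite fg.
Qed.

Lemma cvg_pairl (X Y : topologicalType) (x : X) (y : Y) : (fun z => (z, y)) @ x --> (x, y).
Proof. by move=> A [[P Q] /= [Px /nbhs_singleton Qy] PQ]; apply: filterS Px => z Pz; exact: (PQ (z, y)). Qed.

Lemma cvg_pairr (X Y : topologicalType) (x : X) (y : Y) : (fun z => (x, z)) @ y --> (x, y).
Proof. by move=> A [[P Q] /= [/nbhs_singleton Px Qy] PQ]; apply: filterS Qy => z Qz; exact: (PQ (x, z)). Qed.

Lemma continuous_pair (X Y Z : topologicalType) (f : X -> Y) (g : X -> Z) :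
  continuous f -> continuous g -> continuous (fun x => (f x, g x)).
Proof.
move=> cf cg x A [[P Q] /= [/cf Px /cg Qx] PQ].
have H : nbhs x (f @^-1` P `&` g @^-1` Q) by apply: filterI; [exact: Px|exact: Qx].
by apply: filterS H => z [Pz Qz]; exact: (PQ (f z, g z)).
Qed.

Lemma continuous_compose (X Y Z : topologicalType) (f : X -> Y) (g : Y -> Z) :
  continuous f -> continuous g -> continuous (fun x => g (f x)).
Proof. by move=> cf cg x A /cg /cf. Qed.

Lemma continuous_fst (X Y : topologicalType) : continuous (@fst X Y).
Proof. by move=> x; exact: cvg_fst. Qed.

Lemma continuous_snd (X Y : topologicalType) : continuous (@snd X Y).
Proof. by move=> x; exact: cvg_snd. Qed.

Lemma continuous_const (X Y : topologicalType) (y : Y) : continuous (fun _ : X => y).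
Proof. by move=> x; exact: cvg_cst. Qed.

Ltac continuous_projections := repeat first
  [ apply: continuous_pair | exact: continuous_fst | exact: continuous_snd
  | exact: continuous_const | exact: (fun x => @cvg_id _ (nbhs x))
  | apply: (continuous_compose _ (@continuous_fst _ _))
  | apply: (continuous_compose _ (@continuous_snd _ _)) ].

Lemma continuous_shuffle (X Y Z W : topologicalType) :
  continuous (fun p : (X * W) * (Y * Z) => ((p.1.1, p.2.1), (p.1.2, p.2.2))).
Proof. continuous_projections. Qed.

Lemma continuous_diagonal (X : topologicalType) (I : Type) :
  continuous (fun x : X => (fun=> x) : prod_topology (fun _ : I => X)).
Proof.
move=> x; apply/cvg_sup => i A [_ [[B oB <-] /= Bx BA]].
by apply: filterS BA _; apply: open_nbhs_nbhs.
Qed.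

(** * The mean value estimate in a locally convex space *)

Section mean_value.
Context {R : realType} {F : lcsType R}.
Implicit Types (c : R -> F) (C : set F).

Lemma convex_comb C (k : R) (x y : F) : convex_set C -> 0 <= k <= 1 ->
  C x -> C y -> C (k *: x + (1 - k) *: y).
Proof.
move=> cC /andP[k0 k1] Cx Cy.
have k01 : Itv.spec (@Itv.num_sem R) (Itv.Real `[0%Z, 1%Z]) k.
  by rewrite /Itv.spec /Itv.num_sem/= in_itv/= k0 k1 andbT ger0_real.
by have /set_mem := cC x y (Itv.mk k01) (mem_set Cx) (mem_set Cy).
Qed.

(** The variable is a plain real, so that curves need no vector space structure
    on their domain. *)
Definition is_curve_deriv c (t : R) (l : F) :=
  u^-1 *: (c (t + u) - c t) @[u --> (0 : R)^'] --> l.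

Lemma slope_convex c C (p q r : R) : convex_set C -> p < q -> q < r ->
  C ((q - p)^-1 *: (c q - c p)) -> C ((r - q)^-1 *: (c r - c q)) ->
  C ((r - p)^-1 *: (c r - c p)).
Proof.
move=> cC pq qr C1 C2.
have rp : 0 < r - p by rewrite subr_gt0 (lt_trans pq).
have rp0 : r - p != 0 by rewrite gt_eqF.
have qp0 : q - p != 0 by rewrite subr_eq0 gt_eqF.
have rq0 : r - q != 0 by rewrite subr_eq0 gt_eqF.
have := @convex_comb C ((r - p)^-1 * (q - p)) _ _ cC _ C1 C2.
rewrite !scalerA mulfK//.
have -> : (1 - (r - p)^-1 * (q - p)) * (r - q)^-1 = (r - p)^-1.
  have -> : 1 - (r - p)^-1 * (q - p) = (r - p)^-1 * (r - q).
    by rewrite -{1}(mulVf rp0) -mulrBr opprB addrA subrK.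
  by rewrite mulfK.
rewrite -scalerDr [c q - c p + _]addrC addrA subrK; apply.
apply/andP; split.
  by apply: mulr_ge0; [rewrite invr_ge0 ltW|rewrite subr_ge0 ltW].
by rewrite mulrC ler_pdivrMr// mul1r lerD2r ltW.
Qed.

(** The set of t in ]0, 1] whose slope from 0 lies in C contains small t, and it
    contains its supremum s, as the slope over [0, s] is a convex combination of
    the slope over [0, t] and of a slope close to c'(s).  For the same reason s
    cannot be smaller than 1. *)
Lemma mean_value01 c C (l : R -> F) : convex_set C ->
  (forall t, 0 <= t <= 1 -> is_curve_deriv c t (l t) /\ nbhs (l t) C) ->
  C (c 1 - c 0).
Proof.
move=> cC H.
have loc s : 0 <= s <= 1 -> exists2 e : R, 0 < e &
    forall u, `|u| < e -> u != 0 -> C (u^-1 *: (c (s + u) - c s)).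
  move=> /H[dc nC]; have [e /= e0 eC] := dc _ nC; exists e => // u ue u0.
  by apply: eC => //=; rewrite sub0r normrN.
have [e0 e00 He0] := loc 0 ltac:(by rewrite lexx ler01).
pose S := [set t : R | 0 < t <= 1 /\ C (t^-1 *: (c t - c 0))].
have Sub : ubound S 1 by move=> t [/andP[]].
have S0 : S !=set0.
  pose t := Num.min (e0 / 2) 1; exists t.
  have t0 : 0 < t by rewrite lt_min ltr01 divr_gt0.
  split; first by rewrite t0 /t ge_min lexx orbT.
  have := He0 t; rewrite add0r; apply; last by rewrite gt_eqF.
  by rewrite gtr0_norm// /t gt_min ltr_pdivrMr// ltr_pMr// ltr1n.
have hS : has_sup S by split => //; exists 1.
set s := sup S.
have s0 : 0 < s.
  by have [t St] := S0; have [/andP[t0 _] _] := St; apply: lt_le_trans t0 (ub_le_sup hS.2 St).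
have s1 : s <= 1 by exact: ge_sup.
have [e e_gt0 He] := loc s ltac:(by rewrite (ltW s0)).
have Ss : C (s^-1 *: (c s - c 0)).
  have [t St ts] := sup_adherent e_gt0 hS.
  have ts' : t <= s := ub_le_sup hS.2 St.
  have [/andP[t0 t1] Ct] := St.
  move: ts'; rewrite le_eqVlt => /orP[/eqP<-//|lts].
  have -> : s^-1 *: (c s - c 0) = (s - 0)^-1 *: (c s - c 0) by rewrite subr0.
  apply: (slope_convex cC t0 lts); first by rewrite subr0.
  have -> : (s - t)^-1 *: (c s - c t) = (t - s)^-1 *: (c (s + (t - s)) - c s).
    rewrite (_ : s + (t - s) = t); last by rewrite addrC subrK.
    by rewrite -[s - t]opprB -[c s - c t]opprB scalerN invrN scaleNr opprK.
  apply: He; last by rewrite subr_eq0 lt_eqF.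
  by rewrite distrC gtr0_norm ?subr_gt0// ltrBlDr addrC -ltrBlDr.
move: s1; rewrite le_eqVlt => /orP[/eqP s1|s1].
  by move: Ss; rewrite s1 invr1 scale1r.
pose u := Num.min (e / 2) (1 - s).
have u0 : 0 < u by rewrite lt_min subr_gt0 s1 divr_gt0.
have : S (s + u).
  split.
    by rewrite addr_gt0//= -lerBrDl /u ge_min lexx orbT.
  have ssu : s < s + u by rewrite ltrDl.
  have := @slope_convex c C 0 s (s + u) cC s0 ssu; rewrite !subr0; apply => //.
  rewrite [s + u - s]addrAC subrr add0r; apply: He; last by rewrite gt_eqF.
  by rewrite gtr0_norm// /u gt_min ltr_pdivrMr// ltr_pMr// ltr1n.
by move=> /(ub_le_sup hS.2); rewrite -/s leNgt ltrDl u0.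
Qed.

Lemma mean_value c C (l : R -> F) (t : R) : t != 0 -> convex_set C ->
  (forall u, `|u| <= `|t| -> is_curve_deriv c u (l u) /\ nbhs (l u) C) ->
  C (t^-1 *: (c t - c 0)).
Proof.
move=> t0 cC H.
have := @mean_value01 (fun u => t^-1 *: c (t * u)) C (fun u => l (t * u)) cC.
rewrite mulr1 mulr0 scalerBr; apply => u /andP[u0 u1].
have [|dc nC] := H (t * u).
  by rewrite normrM ler_piMr// ger0_norm.
split=> //; rewrite /is_curve_deriv.
have tu : (fun v : R => t * v) @ (0 : R)^' --> (0 : R)^'.
  move=> A [e /= e_gt0 eA].
  exists (e / `|t|); first by rewrite /= divr_gt0// normr_gt0.
  move=> v /=; rewrite sub0r normrN => ve v0; apply: eA => /=.
    by rewrite sub0r normrN normrM mulrC -ltr_pdivlMr ?normr_gt0.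
  by rewrite mulf_neq0.
have := @cvg_comp _ _ _ _ _ _ _ _ tu dc; apply: cvg_trans; apply: near_eq_cvg; apply: nearW => v /=.
by rewrite -scalerBr scalerA invfM mulrC mulrDr.
Qed.

End mean_value.

(** * Limits of difference quotients *)

Lemma cvg_line (R : realType) (E : tvsType R) (x h : E) :
  (fun t : R => x + t *: h) @ nbhs (0 : R) --> x.
Proof.
have : (fun t : R => x + t *: h) @ nbhs (0 : R) --> x + 0 *: h.
  apply: cvg_addr; first exact: cvg_cst.
  by apply: cvg_scaler; [exact: cvg_id|exact: cvg_cst].
by rewrite scale0r addr0.
Qed.

Lemma cvg_sumr (R : realType) (E : tvsType R) (T I : Type) (G : set_system T) (s : seq I)
    (P : pred I) (f : I -> T -> E) (a : I -> E) (FG : Filter G) :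
  (forall i, f i @ G --> a i) ->
  (fun x => \sum_(i <- s | P i) f i x) @ G --> \sum_(i <- s | P i) a i.
Proof.
move=> fa; elim: s => [|i s IH].
  by under eq_fun do rewrite big_nil; rewrite big_nil; exact: cvg_cst.
under eq_fun do rewrite big_cons; rewrite big_cons; case: (P i) => //.
exact: cvg_addr.
Qed.

Section difference_quotients.
Context {R : realType} {F : lcsType R}.

Lemma nbhs_convex_open (l : F) (A : set F) : nbhs l A ->
  exists C : set F, [/\ open C, convex_set C, C l & C `<=` A].
Proof.
move=> lA; have [B cB [Bo Bb]] := @locally_convex R F.
have [C [BC Cl] CA] := Bb l A lA; exists C; split=> //; first exact: Bo.
by apply: cB; rewrite inE.
Qed.

(** F is regular, so closed neighbourhoods of l suffice; a closed set that
    contains f on a member of Theta contains the limit f' x. *)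
Lemma cvg_closure (X X' : Type) (Psi : set_system X) (Phi : set_system X')
    (f : X -> F) (f' : X' -> F) (l : F) :
  Filter Phi -> Filter Psi -> f @ Psi --> l ->
  (forall A, Psi A -> \forall x \near Phi,
     exists Theta : set_system X, [/\ ProperFilter Theta, Theta A & f @ Theta --> f' x]) ->
  f' @ Phi --> l.
Proof.
move=> FPhi FPsi fl H A lA.
have [B Bl BA] := @uniform_regular F l _ lA.
have := H _ (fl _ Bl); apply: filterS => x [Th [PTh ThB fx]].
apply: BA => N Nx.
have : Th ((f @^-1` N) `&` (f @^-1` B)) by apply: filterI => //; exact: fx.
by move=> /filter_ex[y [Ny By]]; exists (f y).
Qed.

Lemma cvg_iterated (S T : Type) (Phi : set_system S) (G : set_system T)
    (c : S -> T -> F) (c' : S -> F) (l : F) :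
  Filter Phi -> ProperFilter G ->
  (fun p => c p.1 p.2) @ filter_prod Phi G --> l ->
  (\forall s \near Phi, c s @ G --> c' s) -> c' @ Phi --> l.
Proof.
move=> FPhi PG cl cc.
apply: (cvg_closure _ _ cl) => A [[P Q] /= [PhiP GQ] PQ].
apply: filterS (filterI PhiP cc) => s [Ps cs].
exists ((fun t => (s, t)) @ G); split.
- exact: fmap_proper_filter.
- change (G [set t | A (s, t)]).
  by apply: filterS GQ => t Qt; exact: (PQ (s, t)).
- exact: cs.
Qed.

(** Fix t and let the parameter move in D: every f t is continuous, and closed
    neighbourhoods of l survive the limit. *)
Lemma cvg_dense (T : Type) (X : topologicalType) (D : set X)
    (Phi : set_system T) (f : T -> X -> F) (x : X) (l : F) :
  Filter Phi -> closure D = setT ->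
  (\forall t \near Phi, continuous (f t)) ->
  (fun p => f p.1 p.2) @ filter_prod Phi (within D (nbhs x)) --> l ->
  (fun p => f p.1 p.2) @ filter_prod Phi (nbhs x) --> l.
Proof.
move=> FPhi dD cf fl; apply: (cvg_closure _ _ fl) => A [[P Q] /= [PhiP Qx] PQ].
exists (P `&` [set t | continuous (f t)], [set y | within D (nbhs y) Q]).
  split; first exact: filterI.
  exact: (nbhs_interior Qx).
move=> [t y] /= [[Pt ct] Qy].
have PW := within_proper y dD.
exists ((fun z => (t, z)) @ within D (nbhs y)); split.
- exact: fmap_proper_filter.
- change (within D (nbhs y) [set z | A (t, z)]).
  by apply: filterS Qy => z Qz; exact: (PQ (t, z)).
- move=> N Ny; have yN : nbhs y [set z | N (f t z)] by exact: (ct y N Ny).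
  change (nbhs y [set z | D z -> N (f t z)]).
  by apply: filterS yN => z Nz _.
Qed.

(** A convex neighbourhood of l that contains the derivatives also contains the
    slopes, by [mean_value], for all parameters at once. *)
Lemma slopes_cvg (T : Type) (G : set_system T) (a b : R -> T -> F) (l : F) :
  Filter G ->
  (\forall p \near filter_prod (nbhs (0 : R)) G,
     is_curve_deriv (a^~ p.2) p.1 (b p.1 p.2)) ->
  (fun p => b p.1 p.2) @ filter_prod (nbhs (0 : R)) G --> l ->
  (fun p => p.1^-1 *: (a p.1 p.2 - a 0 p.2)) @ filter_prod (0 : R)^' G --> l.
Proof.
move=> FG da bl A /nbhs_convex_open[C [oC cC Cl CA]].
have := bl C (open_nbhs_nbhs (conj oC Cl)).
move=> /(filterI da) [[P Q] /= [[e /= e0 eP] GQ] PQ].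
exists ([set t | t != 0 /\ `|t| < e], Q).
  split=> //; exists e => // t /=; rewrite sub0r normrN => te t0; by split.
move=> [t al] /= [[t0 te] Qal]; apply: CA.
apply: (@mean_value R F (a^~ al) C (b^~ al)) => // u ut.
have [|d Cb] := PQ (u, al).
  by split=> //=; apply: eP; rewrite /= sub0r normrN (le_lt_trans ut).
by split=> //; exact: open_nbhs_nbhs.
Qed.

Lemma is_dir_deriv_curve (G : tvsType R) (f : G -> F) (x h : G) (t : R) (l : F) :
  is_dir_deriv f (x + t *: h) h l <-> is_curve_deriv (fun s => f (x + s *: h)) t l.
Proof.
rewrite /is_dir_deriv /is_curve_deriv; split; apply: cvg_trans; apply: near_eq_cvg;
by apply: nearW => u; rewrite scalerDl addrA.
Qed.

End difference_quotients.

(** * Commutation and additivity of directional derivatives *)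

Section directional_calculus.
Context {R : realType} {G : tvsType R} {F : lcsType R}.
Implicit Types (O : set G) (f g : G -> F) (v w h : G).

Lemma cvg_plane (x v w : G) :
  (fun p : R * R => x + p.1 *: v + p.2 *: w) @ filter_prod (nbhs (0 : R)) (nbhs (0 : R)) --> x.
Proof.
have : (fun p : R * R => x + p.1 *: v + p.2 *: w) @ filter_prod (nbhs (0 : R)) (nbhs (0 : R))
    --> x + 0 *: v + 0 *: w.
  apply: cvg_addr; last by apply: cvg_scaler; [exact: cvg_snd|exact: cvg_cst].
  apply: cvg_addr; first exact: cvg_cst.
  by apply: cvg_scaler; [exact: cvg_fst|exact: cvg_cst].
by rewrite !scale0r !addr0.
Qed.

Lemma near_plane O (x v w : G) : open O -> O x ->
  \forall p \near filter_prod (nbhs (0 : R)) (nbhs (0 : R)), O (x + p.1 *: v + p.2 *: w).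
Proof. by move=> oO Ox; apply: cvg_plane; exact: open_nbhs_nbhs. Qed.

Lemma is_curve_deriv_scaleB (c1 c2 : R -> F) (k t : R) (l1 l2 : F) :
  is_curve_deriv c1 t l1 -> is_curve_deriv c2 t l2 ->
  is_curve_deriv (fun s => k *: (c1 s - c2 s)) t (k *: (l1 - l2)).
Proof.
move=> d1 d2; have FF : Filter (0 : R)^' by exact: _.
have L := cvg_scaler FF (@cvg_cst _ k _ _ FF) (cvg_lin (k := -1) FF d2 d1).
rewrite (_ : l1 - l2 = -1 *: l2 + l1); last by rewrite scaleN1r addrC.
apply: cvg_trans L; apply: near_eq_cvg; apply: nearW => u.
rewrite scaleN1r [- _ + _]addrC -!scalerBr !scalerA [k * _]mulrC.
by rewrite !opprB [c2 t - c2 _]addrC addrACA [- c1 _ + _]addrC.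
Qed.

(** Let c s t be the difference quotient of f in the direction w at x + s v.
    Two applications of [slopes_cvg] show that (c s t - c 0 t) / s tends to
    D_w D_v f x as s and t tend to 0 independently; letting t go to 0 first
    turns this into the limit that defines D_v D_w f x. *)
Lemma dir_derivC O f (x v w : G) : open O -> O x ->
  (forall z, O z -> dir_derivable f z v) -> (forall z, O z -> dir_derivable f z w) ->
  (forall z, O z -> dir_derivable (dir_deriv v f) z w) ->
  {for x, continuous (dir_deriv w (dir_deriv v f))} ->
  dir_deriv v (dir_deriv w f) x = dir_deriv w (dir_deriv v f) x.
Proof.
move=> oO Ox dv dw dvw cvw; apply: dir_derivE.
set l := dir_deriv w (dir_deriv v f) x in cvw *.
pose c (s t : R) := t^-1 *: (f (x + s *: v + t *: w) - f (x + s *: v)).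
pose b (s t : R) := t^-1 *: (dir_deriv v f (x + s *: v + t *: w) - dir_deriv v f (x + s *: v)).
have dn : (0 : R)^' --> nbhs (0 : R) by exact: nbhs_dnbhs.
(* The derivative b of c ^~ t is itself a slope, in the direction w, of D_v f. *)
have bl : (fun p => b p.1 p.2) @ filter_prod (nbhs (0 : R)) (0 : R)^' --> l.
  have H : (fun p => b p.2 p.1) @ filter_prod (0 : R)^' (nbhs (0 : R)) --> l.
    have C := @cvg_comp _ _ _ _ _ _ _ _ (@cvg_plane x v w) cvw.
    have D := @cvg_comp _ _ _ _ _ _ _ _ (@filter_prod_swap _ _ (nbhs (0 : R)) (nbhs (0 : R))) C.
    have N : \forall p \near filter_prod (nbhs (0 : R)) (nbhs (0 : R)), O (x + p.2 *: v + p.1 *: w).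
      exact: (@filter_prod_swap _ _ (nbhs (0 : R)) (nbhs (0 : R)) _ (near_plane v w oO Ox)).
    pose a t s := dir_deriv v f (x + s *: v + t *: w).
    have -> : (fun p : R * R => b p.2 p.1) = (fun p => p.1^-1 *: (a p.1 p.2 - a 0 p.2)).
      by apply/funext => -[t s]; rewrite /a /b scale0r addr0.
    pose b' t s := dir_deriv w (dir_deriv v f) (x + s *: v + t *: w).
    apply: (@slopes_cvg R F R _ a b' _ _ _ D); apply: filterS N => -[t s] /= Oz.
    exact/is_dir_deriv_curve/dir_derivP/dvw.
  exact: (@cvg_comp _ _ _ _ _ _ _ _ (@filter_prod_swap _ _ _ _) H).
have cl : (fun p => p.1^-1 *: (c p.1 p.2 - c 0 p.2)) @ filter_prod (0 : R)^' (0 : R)^' --> l.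
  apply: (@slopes_cvg R F R (0 : R)^' c b l _ _ bl).
  have N : \forall p \near filter_prod (nbhs (0 : R)) (0 : R)^',
      O (x + p.1 *: v + p.2 *: w) /\ O (x + p.1 *: v + p.2 *: 0).
    apply: (filter_prod_sub (@cvg_id _ (nbhs (0 : R))) dn).
    exact: filterI (near_plane v w oO Ox) (near_plane v 0 oO Ox).
  apply: filterS N => -[s t] /=; rewrite scaler0 addr0 => -[O1 O2].
  apply: is_curve_deriv_scaleB; last exact/is_dir_deriv_curve/dir_derivP/dv.
  rewrite addrAC in O1 *; have /is_dir_deriv_curve := dir_derivP (dv _ O1).
  by apply: cvg_trans; apply: near_eq_cvg; apply: nearW => u; rewrite !(addrAC x _ (t *: w)).
rewrite /is_dir_deriv.
apply: (@cvg_iterated R F R R (0 : R)^' (0 : R)^'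
  (fun s t => s^-1 *: (c s t - c 0 t)) _ _ _ _ cl).
apply: filterS (near_line v oO Ox) => s Os.
apply: cvg_scaler; first exact: cvg_cst.
apply: cvg_addr; first exact/dir_derivP/dw.
rewrite -scaleN1r; under eq_fun do rewrite -scaleN1r.
apply: cvg_scaler; first exact: cvg_cst.
by rewrite /c scale0r addr0; exact/dir_derivP/dw.
Qed.

(** Go from x to x + t (v + w) through x + t v: the second leg contributes
    D_w f x because its base point tends to x along with t. *)
Lemma dir_derivD O f (x v w : G) : open O -> O x ->
  (forall z, O z -> dir_derivable f z w) ->
  {for x, continuous (dir_deriv w f)} -> dir_derivable f x v ->
  dir_deriv (v + w) f x = dir_deriv v f x + dir_deriv w f x.
Proof.
move=> oO Ox dw cw dv; apply: dir_derivE; rewrite [dir_deriv v f x + _]addrC.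
have sl : (fun p => p.1^-1 *: (f (x + p.2 *: v + p.1 *: w) - f (x + p.2 *: v)))
    @ filter_prod (0 : R)^' (nbhs (0 : R)) --> dir_deriv w f x.
  have C := @cvg_comp _ _ _ _ _ _ _ _ (@cvg_plane x v w) cw.
  have D := @cvg_comp _ _ _ _ _ _ _ _ (@filter_prod_swap _ _ (nbhs (0 : R)) (nbhs (0 : R))) C.
  have N : \forall p \near filter_prod (nbhs (0 : R)) (nbhs (0 : R)), O (x + p.2 *: v + p.1 *: w).
    exact: (@filter_prod_swap _ _ (nbhs (0 : R)) (nbhs (0 : R)) _ (near_plane v w oO Ox)).
  pose a s t := f (x + t *: v + s *: w).
  rewrite (_ : (fun p => _) = (fun p : R * R => p.1^-1 *: (a p.1 p.2 - a 0 p.2))); last first.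
    by apply/funext => -[t s]; rewrite /a /= scale0r addr0.
  pose b s t := dir_deriv w f (x + t *: v + s *: w).
  apply: (@slopes_cvg R F R _ a b _ _ _ D); apply: filterS N => -[s t] /= Oz.
  exact/is_dir_deriv_curve/dir_derivP/dw.
have dg : (fun t : R => (t, t)) @ (0 : R)^' --> filter_prod (0 : R)^' (nbhs (0 : R)).
  move=> A [[P Q] [/= P0 /nbhs_dnbhs Q0] PQ].
  change ((0 : R)^' [set t | A (t, t)]).
  by apply: filterS (filterI P0 Q0) => t Pt; exact: (PQ (t, t)).
have FF : Filter (0 : R)^' by exact: _.
have L := cvg_addr FF (@cvg_comp _ _ _ _ _ _ _ _ dg sl) (dir_derivP dv).
apply: cvg_trans L; apply: near_eq_cvg; apply: nearW => t /=.
by rewrite [t *: (v + w)]scalerDr addrA -[LHS]scalerDr addrA subrK.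
Qed.

Lemma dir_deriv0 f : dir_deriv 0 f = 0.
Proof.
apply/funext => x; apply: dir_derivE; rewrite /is_dir_deriv.
under eq_fun do rewrite scaler0 addr0 subrr scaler0.
exact: cvg_cst.
Qed.

Lemma iter_deriv_cat hs1 hs2 f : iter_deriv (hs1 ++ hs2) f = iter_deriv hs2 (iter_deriv hs1 f).
Proof. by elim: hs1 f => /=. Qed.

Lemma iter_derivable_cat O hs1 hs2 f :
  iter_derivable O (hs1 ++ hs2) f <->
  iter_derivable O hs1 f /\ iter_derivable O hs2 (iter_deriv hs1 f).
Proof.
elim: hs1 f => [|h hs1 IH] f /=; first by split=> // -[].
by split=> [[df /IH[d1 d2]]|[[df d1] d2]]; split=> //; apply/IH.
Qed.

(** Continuity is asked for each fixed list of directions; this is all that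
    symmetry and additivity of the derivatives use. *)
Definition smooth_on (n : nat) O f := forall hs, (size hs <= n)%N ->
  iter_derivable O hs f /\ forall x, O x -> {for x, continuous (iter_deriv hs f)}.

Lemma smooth_on_deriv n O f (h : G) : smooth_on n.+1 O f -> smooth_on n O (dir_deriv h f).
Proof. by move=> sf hs hn; have [[_ d] c] := sf (h :: hs) hn. Qed.

Lemma smooth_on_dir_derivable n O f h x : smooth_on n.+1 O f -> O x -> dir_derivable f x h.
Proof. by move=> sf Ox; have [[df _] _] := sf [:: h] isT; exact: df. Qed.

Lemma iter_deriv_swap O f v w hs x : open O -> O x -> smooth_on (size hs).+2 O f ->
  iter_deriv [:: v, w & hs] f x = iter_deriv [:: w, v & hs] f x.
Proof.
move=> oO Ox sf /=.
have E z : O z -> dir_deriv w (dir_deriv v f) z = dir_deriv v (dir_deriv w f) z.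
  move=> Oz; apply/esym/(@dir_derivC O) => //.
  - by move=> y Oy; exact: smooth_on_dir_derivable _ sf Oy.
  - by move=> y Oy; exact: smooth_on_dir_derivable _ sf Oy.
  - by move=> y Oy; exact: (smooth_on_dir_derivable _ (smooth_on_deriv v sf) Oy).
  - by have [_ cf] := sf [:: v; w] isT; exact: cf.
have [[_ d] _] := sf [:: v, w & hs] (leqnn _).
by have [_ ->] := iter_deriv_eq oO E d.2.
Qed.

(** Transport h by successive transpositions. *)
Lemma iter_deriv_move O f h hs1 hs2 x : open O -> O x ->
  smooth_on (size (hs1 ++ hs2)).+1 O f ->
  iter_deriv (h :: hs1 ++ hs2) f x = iter_deriv (hs1 ++ h :: hs2) f x.
Proof.
move=> oO Ox; elim: hs1 f => [//|v hs1 IH] f sf.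
by rewrite cat_cons (iter_deriv_swap _ _ oO Ox sf) /= -IH//; exact: smooth_on_deriv.
Qed.

Lemma iter_deriv_perm O f hs1 hs2 x : open O -> O x -> perm_eq hs1 hs2 ->
  smooth_on (size hs1) O f -> iter_deriv hs1 f x = iter_deriv hs2 f x.
Proof.
move=> oO Ox; elim: hs1 hs2 f => [|h hs1 IH] hs2 f p sf.
  by move: p; rewrite perm_sym => /perm_nilP ->.
have : h \in hs2 by rewrite -(perm_mem p) mem_head.
move=> /path.splitPr E; case: E p => s1 s2 p.
have p' : perm_eq hs1 (s1 ++ s2).
  by rewrite -(perm_cons h) (perm_trans p)// -cat1s perm_catCA.
rewrite -(@iter_deriv_move O)// -?(perm_size p')//=.
by apply: IH => //; exact: smooth_on_deriv.
Qed.

Lemma iter_deriv_sum O f (I : Type) (s : seq I) (e : I -> G) hs x : open O -> O x ->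
  smooth_on (size hs).+1 O f ->
  iter_deriv (\sum_(i <- s) e i :: hs) f x = \sum_(i <- s) iter_deriv (e i :: hs) f x.
Proof.
move=> oO Ox sf; elim: s => [|i s IH].
  by rewrite !big_nil /= dir_deriv0; have [_ ->] := iter_deriv0 (F := F) hs oO.
rewrite !big_cons -IH /=.
set v := e i; set w := \sum_(j <- s) e j.
have E z : O z -> (1 *: dir_deriv v f + dir_deriv w f) z = dir_deriv (v + w) f z.
  move=> Oz; rewrite scale1r; apply/esym/(@dir_derivD O) => //.
  - by move=> y Oy; exact: smooth_on_dir_derivable _ sf Oy.
  - by have [_ cf] := sf [:: w] isT; exact: cf.
  - exact: smooth_on_dir_derivable _ sf Oz.
have d h : iter_derivable O hs (dir_deriv h f) by have [[]] := sf (h :: hs) (leqnn _).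
have [d' E1] := iter_deriv_lin 1 oO (d v) (d w).
by have [_ <-//] := iter_deriv_eq oO E d'; rewrite E1// scale1r.
Qed.

End directional_calculus.

(** * Polarization *)

Section polarization.
Context {R : realType} {G : tvsType R} {F : lcsType R}.
Implicit Types (O : set G) (f : G -> F).

Lemma iter_deriv_nseq_sum O f k n (w : 'I_n -> G) (S : {set 'I_n}) x :
  open O -> O x -> smooth_on k O f ->
  iter_deriv (nseq k (\sum_(i in S) w i)) f x =
  \sum_(t : k.-tuple 'I_n | all (mem S) t) iter_deriv (map w t) f x.
Proof.
move=> oO Ox; elim: k f => [|k IH] f sf /=.
  by rewrite (big_pred1 [tuple])// => t; rewrite (tuple0 t) /= eqxx.
have E : iter_deriv (\sum_(i in S) w i :: nseq k (\sum_(i in S) w i)) f x =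
    \sum_(i in S) iter_deriv (nseq k (\sum_(i in S) w i)) (dir_deriv (w i) f) x.
  rewrite -{1}[\sum_(i in S) w i]big_enum (iter_deriv_sum _ _ oO Ox) ?size_nseq//.
  by rewrite big_enum.
rewrite [LHS]E (eq_bigr _ (fun i _ => IH _ (smooth_on_deriv (w i) sf))).
rewrite (pair_big_dep (mem S) (fun _ (t : k.-tuple 'I_n) => all (mem S) t)
  (fun i (t : k.-tuple 'I_n) => iter_deriv (map w t) (dir_deriv (w i) f) x)) /=.
rewrite (reindex (fun p : 'I_n * k.-tuple 'I_n => [tuple of p.1 :: p.2])) /=.
  by apply: eq_big => // -[i t].
exists (fun t : k.+1.-tuple 'I_n => (thead t, [tuple of behead t])) => [[i t]|t] _ /=.
  by congr pair; apply/val_inj.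
by rewrite [RHS]tuple_eta.
Qed.

(** Equal to (-1) ^ #|~: S|; the product form makes [polar_signE] an instance of
    distributivity. *)
Definition polar_sign k (S : {set 'I_k}) : R := \prod_(i < k) (if i \in S then 1 else -1).

(** The alternating sum factors as the product over i of 1 - (i \notin t), which
    vanishes unless every i occurs in t; for k entries in 'I_k this means that t
    has no repetition. *)
Lemma polar_signE k (t : k.-tuple 'I_k) :
  \sum_(S : {set 'I_k} | all (mem S) t) polar_sign S = (uniq t)%:R.
Proof.
transitivity (\prod_(i < k) (1 + (if i \in t then 0 else -1)) : R).
  rewrite bigA_distr big_mkcond; apply: eq_bigr => S _; case: ifPn => [/allP tS|/allPn[i it /= iS]].
    by apply: eq_bigr => i _; case: ifPn => // iS; case: ifPn => // /tS /=; rewrite (negPf iS).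
  by apply/esym/eqP/prodf_eq0; exists i => //; rewrite (negPf iS) it.
case: (boolP (uniq t)) => ut.
  have /subset_cardP H : #|t| = #|'I_k| by rewrite (card_uniqP ut) size_tuple card_ord.
  have {}H := H (subset_predT _).
  by rewrite big1// => i _; rewrite H addr0.
have [i it] : exists i, i \notin t.
  apply/existsP; rewrite -negb_forall; apply: contra ut => /forallP H.
  by apply/card_uniqP; rewrite (eq_card (B := 'I_k)) ?card_ord ?size_tuple// => i; rewrite H.
by rewrite (bigD1 i)//= (negPf it) subrr mul0r.
Qed.

(** Expand each diagonal value over all k-tuples of directions.  The signed sum
    over S kills the tuples with repetitions; by symmetry each of the k!
    remaining ones contributes the same value. *)
Lemma iter_deriv_polarization O f k (w : 'I_k -> G) x :
  open O -> O x -> smooth_on k O f ->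
  (k`!)%:R *: iter_deriv (map w (enum 'I_k)) f x =
  \sum_(S : {set 'I_k}) polar_sign S *: iter_deriv (nseq k (\sum_(i in S) w i)) f x.
Proof.
move=> oO Ox sf.
under [RHS]eq_bigr => S _ do rewrite (iter_deriv_nseq_sum _ _ oO Ox sf) scaler_sumr big_mkcond.
rewrite exchange_big /=.
transitivity (\sum_(t : k.-tuple 'I_k | uniq t) iter_deriv (map w (enum 'I_k)) f x).
  rewrite sumr_const -scaler_nat; congr (_%:R *: _).
  have := card_uniq_tuples k (mem 'I_k); rewrite card_ord ffactnn => <-.
  by rewrite cardsE; apply: eq_card => t; rewrite unfold_in /= (_ : all _ _ = true)//; apply/allP.
rewrite big_mkcond; apply: eq_bigr => t _.
rewrite -big_mkcond /= -scaler_suml polar_signE; case: (boolP (uniq t)) => ut; last by rewrite scale0r.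
rewrite scale1r; apply: (iter_deriv_perm oO Ox); last by rewrite size_map size_enum_ord.
apply: perm_map; apply: uniq_perm; rewrite ?enum_uniq// => i; rewrite mem_enum.
have /subset_cardP H : #|t| = #|'I_k| by rewrite (card_uniqP ut) size_tuple card_ord.
by have {}H := H (subset_predT _); rewrite H.
Qed.

End polarization.

(** * Jets of a differentiable map *)

Lemma order_le0 r : order_le 0 r. Proof. by case: r. Qed.

Lemma order_leS k r : order_le k.+1 r -> order_le k r.
Proof. by case: r => //= n; exact: ltnW. Qed.

Lemma order_le_trans j k r : (j <= k)%N -> order_le k r -> order_le j r.
Proof. by case: r => //= n; exact: leq_trans. Qed.

Section interior_points.
Context {R : realType} {E : lcsType R} {U : lcsubset E} {F : lcsType R}.

Lemma Cr_ext0E (f : U -> F) (x : U) : Cr_ext0 f (set_val x) = f x.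
Proof. exact: (congr1 (fun g => g x) (@valLK _ _ 0 _ f)). Qed.

Lemma interior_lift z : U° z -> exists x : U, set_val x = z.
Proof. by move=> /interior_subset/mem_set Uz; exists (exist _ z Uz). Qed.

(** The inclusion of U is open at interior points. *)
Lemma nbhs_lift (x : U) (P : set U) : U° (set_val x) -> nbhs x P ->
  nbhs (set_val x) [set z | exists x' : U, [/\ set_val x' = z, U° z & P x']].
Proof.
move=> Ux [_ [[B oB <-] /= Bx BP]].
have BU : nbhs (set_val x) (B `&` U°).
  by apply: filterI; apply: open_nbhs_nbhs; split=> //; exact: open_interior.
apply: filterS BU => z [Bz Uz].
by have [x' x'z] := interior_lift Uz; exists x'; split=> //; apply: BP; rewrite /= x'z.
Qed.

Lemma Cr_ext0_cvg (X : Type) (G : set_system X) (B : U -> X -> F) (x : U) (l : F) :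
  Filter G -> U° (set_val x) ->
  (fun p => B p.1 p.2) @ filter_prod (nbhs x) G --> l ->
  (fun p : E * X => Cr_ext0 (B^~ p.2) p.1) @ filter_prod (nbhs (set_val x)) G --> l.
Proof.
move=> FG Ux Bl A /Bl[[P Q] /= [Px GQ] PQ].
exists ([set z | exists x' : U, [/\ set_val x' = z, U° z & P x']], Q).
  by split=> //; exact: nbhs_lift.
move=> [z q] /= [[x' [<- _ Px']] Qq]; rewrite Cr_ext0E.
exact: (PQ (x', q)).
Qed.

Lemma smooth_on_Cr r (f : U -> F) k : Cr r f -> order_le k r ->
  smooth_on k U° (Cr_ext0 f).
Proof.
move=> Cf kr hs hk; have [[df cf] _] := Cf (size hs) (order_le_trans hk kr).
pose y : cartesian_power E (size hs) := fun i => nth 0 hs i.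
have ys : Cr_dirs y = hs.
  rewrite /Cr_dirs /y -[RHS](mkseq_nth 0) /mkseq -val_enum_ord -map_comp.
  exact: eq_map.
rewrite -ys; split=> // x Ux.
have oUT : open (U° `*` [set: cartesian_power E (size hs)]).
  rewrite openE => -[x' y'] [/= Ux' _]; exists (U°, setT) => //; split=> //=.
    by apply: open_nbhs_nbhs; split=> //; exact: open_interior.
  exact: filterT.
rewrite continuous_open_subspace// in cf.
have /cf c : (x, y) \in U° `*` [set: cartesian_power E (size hs)] by rewrite inE.
by move=> A /c; exact: cvg_pairl.
Qed.

End interior_points.

Section jets.
Context {R : realType} {E : lcsType R} {U : lcsubset E} {F : lcsType R}.

(** The map d^(k) f.  Unlike in [Cr_d], the order k does not carry a proof of
    k <= r. *)
Definition Cr_jet k (f : U -> F) : U * cartesian_power E k -> F :=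
  the_deriv_ext (@Cr_dirs R E k) U° set_val (Cr_ext0 f) f.

Arguments Cr_jet : clear implicits.

Definition power_init k (y : cartesian_power E k.+1) : cartesian_power E k :=
  fun i => y (widen_ord (leqnSn k) i).

Lemma Cr_dirsS k (y : cartesian_power E k.+1) :
  Cr_dirs y = rcons (Cr_dirs (power_init y)) (y ord_max).
Proof. by rewrite /Cr_dirs /image_mem enum_ordSr map_rcons -map_comp. Qed.

Lemma Cr_dirs0 (y : cartesian_power E 0) : Cr_dirs y = [::].
Proof. by apply: size0nil; rewrite size_map size_enum_ord. Qed.

Lemma Cr_jetP r k (f : U -> F) : Cr r f -> order_le k r ->
  deriv_ext (@Cr_dirs R E k) U° set_val (Cr_ext0 f) f (Cr_jet k f).
Proof. by move=> Cf kr; apply: the_deriv_extP; have [_] := Cf k kr. Qed.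

Lemma Cr_jet_continuous r k (f : U -> F) : Cr r f -> order_le k r ->
  continuous (Cr_jet k f).
Proof. by move=> Cf kr; have [] := Cr_jetP Cf kr. Qed.

Lemma Cr_jet0 r (f : U -> F) x y : Cr r f -> Cr_jet 0 f (x, y) = f x.
Proof. by move=> Cf; have [_ _] := Cr_jetP Cf (order_le0 r); apply; exact: Cr_dirs0. Qed.

Lemma Cr_jetE r k (f : U -> F) x y : Cr r f -> order_le k r -> U° (set_val x) ->
  Cr_jet k f (x, y) = iter_deriv (Cr_dirs y) (Cr_ext0 f) (set_val x).
Proof. by move=> Cf kr Ux; have [_ ->] := Cr_jetP Cf kr. Qed.

Lemma iter_derivable_rcons (G : tvsType R) (O : set G) hs h (f : G -> F) :
  iter_derivable O (rcons hs h) f <->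
  iter_derivable O hs f /\ forall x, O x -> dir_derivable (iter_deriv hs f) x h.
Proof. by rewrite -cats1 iter_derivable_cat /=; split=> [[? []]|[]]. Qed.

Lemma iter_deriv_rcons (G : tvsType R) hs h (f : G -> F) :
  iter_deriv (rcons hs h) f = dir_deriv h (iter_deriv hs f).
Proof. by rewrite -cats1 iter_deriv_cat. Qed.

Lemma Cr_jet_deriv r k (f : U -> F) x (y : cartesian_power E k.+1) :
  Cr r f -> order_le k.+1 r -> U° (set_val x) ->
  is_dir_deriv (Cr_ext0 (fun x' => Cr_jet k f (x', power_init y))) (set_val x)
    (y ord_max) (Cr_jet k.+1 f (x, y)).
Proof.
move=> Cf kr Ux; rewrite (Cr_jetE _ Cf)// Cr_dirsS iter_deriv_rcons.
have [[/(_ y) df _] _] := Cf _ kr; move: df; rewrite Cr_dirsS iter_derivable_rcons => -[_ dd].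
apply: (is_dir_deriv_eq (@open_interior _ _) Ux) (dir_derivP (dd _ Ux)) => z Uz.
have [x' x'z] := interior_lift Uz; rewrite -x'z Cr_ext0E (Cr_jetE _ Cf) ?x'z//.
exact: order_leS.
Qed.

(** Continuity of derivatives on the open set O follows from that of their
    extension g to X, the inclusion being open over O. *)
Lemma within_image_continuous (X Y : topologicalType) (G : tvsType R) (O : set G)
    (incl : X -> G) (g : X * Y -> F) (phi : G * Y -> F) :
  open O ->
  (forall x P, O (incl x) -> nbhs x P ->
    nbhs (incl x) [set z | exists2 x', incl x' = z & P x']) ->
  (forall z, O z -> exists x, incl x = z) ->
  continuous g -> (forall x y, O (incl x) -> phi (incl x, y) = g (x, y)) ->
  {within O `*` setT, continuous phi}.
Proof.
move=> oO lift sur cg phig; have oOT : open (O `*` [set: Y]).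
  rewrite openE => -[x' y'] [/= Ox' _]; exists (O, setT) => //; split=> //=.
    by apply: open_nbhs_nbhs; split.
  exact: filterT.
rewrite continuous_open_subspace// => -[z y] /set_mem[/= Oz _].
have [x xz] := sur _ Oz; rewrite -xz in Oz *.
move=> A; rewrite phig// => /cg[[P Q] /= [Px Qy] PQ].
exists ([set z | exists2 x', incl x' = z & P x'] `&` O, Q).
  by split=> //; apply: filterI; [exact: lift|exact: open_nbhs_nbhs].
move=> [z' y'] /= [[[x' <- Px'] Ox'] Qy']; rewrite /= phig//.
exact: (PQ (x', y')).
Qed.

(** One derivative at a time: induction on k assembles the hypotheses into the
    iterated derivatives of f and identifies these with g k. *)
Lemma Cr_intro r (f : U -> F) (g : forall k, U * cartesian_power E k -> F) :
  (forall k, order_le k r -> continuous (g k)) ->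
  (forall x y, g 0%N (x, y) = f x) ->
  (forall k x (y : cartesian_power E k.+1), order_le k.+1 r -> U° (set_val x) ->
    is_dir_deriv (Cr_ext0 (fun x' => g k (x', power_init y))) (set_val x)
      (y ord_max) (g k.+1 (x, y))) ->
  Cr r f /\ forall k, order_le k r -> Cr_jet k f = g k.
Proof.
move=> cg g0 dg; pose phi := Cr_ext0 f.
have H k (y : cartesian_power E k) : order_le k r ->
    iter_derivable U° (Cr_dirs y) phi /\
    (forall x : U, U° (set_val x) -> iter_deriv (Cr_dirs y) phi (set_val x) = g k (x, y)).
  elim: k y => [|k IH] y kr.
    by rewrite Cr_dirs0; split=> // x _; rewrite /= g0 /phi Cr_ext0E.
  have [d1 d2] := IH (power_init y) (order_leS kr).
  have D (x : U) : U° (set_val x) ->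
      is_dir_deriv (iter_deriv (Cr_dirs (power_init y)) phi) (set_val x) (y ord_max) (g k.+1 (x, y)).
    move=> Ux; apply: (is_dir_deriv_eq (@open_interior _ _) Ux) (dg k x y kr Ux) => z Uz.
    by have [x' x'z] := interior_lift Uz; rewrite -x'z Cr_ext0E d2// x'z.
  rewrite Cr_dirsS iter_derivable_rcons iter_deriv_rcons; split.
    split=> // z Uz; have [x xz] := interior_lift Uz.
    by rewrite -xz in Uz *; exists (g k.+1 (x, y)); exact: D.
  by move=> x Ux; exact/dir_derivE/D.
(* For k > 0 the list of directions is not empty, so the last clause of
   deriv_ext bears on k = 0 only. *)
have J k : order_le k r -> deriv_ext (@Cr_dirs R E k) U° set_val phi f (g k).
  move=> kr; split; first exact: cg.
    by move=> x y Ux; have [_ ->] := H k y kr.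
  by case: k kr => [|k] kr x y; [rewrite g0|rewrite Cr_dirsS; case: (Cr_dirs _)].
split; last first.
  by move=> k kr; have K := the_deriv_extE (Cr_dense U) (J k kr); exact: K.
move=> k kr; split; last by exists (g k); exact: J.
split; first by move=> y; have [] := H k y kr.
apply: (within_image_continuous (@open_interior _ _) _ _ (cg k kr)).
- move=> x P Ux Px; apply: filterS (nbhs_lift Ux Px) => z [x' [x'z _ Px']].
  by exists x'.
- by move=> z /interior_lift.
- by move=> x y Ux /=; have [_ ->] := H k y kr.
Qed.

End jets.
Arguments Cr_jet {R E U F} k f.

(** * Limits of jets and convergence in the space of C^r-maps *)

Lemma Cr_dirs_const (R : realType) (E : lcsType R) k (e : E) :
  Cr_dirs ((fun=> e) : cartesian_power E k) = nseq k e.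
Proof.
rewrite /Cr_dirs /image_mem -[in RHS](size_enum_ord k).
by elim: (enum 'I_k) => //= i s ->.
Qed.

Section limits_of_jets.
Context {R : realType} {E : lcsType R} {U : lcsubset E} {F : lcsType R}.

Lemma near_line_lift (x : U) (h : E) : U° (set_val x) ->
  \forall t \near (0 : R), exists2 x' : U, set_val x' = set_val x + t *: h & U° (set_val x').
Proof.
move=> Ux; have N := nbhs_lift Ux (@filterT _ (nbhs x) (nbhs_filter x)).
apply: filterS (cvg_near (@cvg_line R E (set_val x) h) N) => t [x' [x't Ux' _]].
by exists x'; rewrite ?x't.
Qed.

Lemma cvg_line_ext0 (T : Type) (G : set_system T) (B : U -> T -> F) (x : U) (h : E) (l : F) :
  Filter G -> U° (set_val x) ->
  (fun p => B p.1 p.2) @ filter_prod (nbhs x) G --> l ->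
  (fun p : R * T => Cr_ext0 (B^~ p.2) (set_val x + p.1 *: h)) @ filter_prod (nbhs (0 : R)) G --> l.
Proof.
move=> FG Ux /(Cr_ext0_cvg FG Ux) Bl.
have C := @filter_prod_mapl R E T (nbhs (0 : R)) (nbhs (set_val x)) G _ (@cvg_line R E (set_val x) h).
move=> N /Bl BN; exact: (C _ BN).
Qed.

(** For parameters in D this is [slopes_cvg]; the remaining ones, which are
    boundary points in the applications, are reached by density. *)
Lemma partial_difference_quotient (X : topologicalType) (D : set X) (A B : U * X -> F)
    (x : U) (h : E) (q : X) :
  closure D = setT -> continuous A -> continuous B -> U° (set_val x) ->
  (forall x' q, U° (set_val x') -> D q ->
    is_dir_deriv (Cr_ext0 (fun z => A (z, q))) (set_val x') h (B (x', q))) ->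
  (fun p : R * X => p.1^-1 *:
     (Cr_ext0 (fun z => A (z, p.2)) (set_val x + p.1 *: h) - A (x, p.2)))
    @ filter_prod (0 : R)^' (nbhs q) --> B (x, q).
Proof.
move=> dD cA cB Ux dA.
apply: (@cvg_dense R F R X D _ (fun t q => t^-1 *:
  (Cr_ext0 (fun z => A (z, q)) (set_val x + t *: h) - A (x, q))) q) => //.
  have : \forall t \near (0 : R)^', exists2 x' : U, set_val x' = set_val x + t *: h & U° (set_val x').
    by apply: nbhs_dnbhs; exact: near_line_lift.
  apply: filterS => t [x' xt Ux'] q'; rewrite -xt.
  apply: cvg_scaler; first exact: cvg_cst.
  under eq_fun do rewrite Cr_ext0E -scaleN1r.
  rewrite Cr_ext0E -scaleN1r; apply: cvg_addr.
    by move=> N /cA; exact: cvg_pairr.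
  apply: cvg_scaler; first exact: cvg_cst.
  by move=> N /cA; exact: cvg_pairr.
pose a (t : R) q := Cr_ext0 (fun z => A (z, q)) (set_val x + t *: h).
pose b (t : R) q := Cr_ext0 (fun z => B (z, q)) (set_val x + t *: h).
rewrite (_ : (fun p => _) = (fun p : R * X => p.1^-1 *: (a p.1 p.2 - a 0 p.2))); last first.
  by apply/funext => -[t q']; rewrite /a /= scale0r addr0 Cr_ext0E.
apply: (@slopes_cvg R F X _ a b).
  exists ([set t : R | exists2 x' : U, set_val x' = set_val x + t *: h & U° (set_val x')], D).
    by split; [exact: near_line_lift|exact: withinT].
  move=> [t q'] /= [[x' xt Ux'] Dq']; apply/is_dir_deriv_curve.
  by rewrite /b -xt Cr_ext0E; exact: dA.
apply: (@cvg_line_ext0 _ _ (fun z q => B (z, q))) => //.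
move=> N /cB[[P Q] /= [Px Qq] PQ]; exists (P, Q); last first.
  by move=> [z q'] /= PQz; exact: (PQ (z, q')).
split=> //=; change (nbhs q [set z | D z -> Q z]).
by apply: filterS Qq => z Qz _.
Qed.

(** By [slopes_cvg] the difference quotients of the k-th jets of h t converge to
    g k.+1 jointly in the increment and along G, so the limit along G may be
    taken first; it turns them into difference quotients of g k. *)
Lemma Cr_closed r (T : Type) (G : set_system T) (h : T -> U -> F) (f : U -> F)
    (g : forall k, U * cartesian_power E k -> F) :
  ProperFilter G -> (\forall t \near G, Cr r (h t)) ->
  (forall k, order_le k r -> continuous (g k)) ->
  (forall x y, g 0%N (x, y) = f x) ->
  (forall k q, order_le k r ->
    (fun p => Cr_jet k (h p.1) p.2) @ filter_prod G (nbhs q) --> g k q) ->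
  Cr r f /\ forall k, order_le k r -> Cr_jet k f = g k.
Proof.
move=> PG Ch cg g0 hg; apply: Cr_intro => // k x y kr Ux.
have pt j q : order_le j r -> (fun t => Cr_jet j (h t) q) @ G --> g j q.
  move=> jr N /(hg _ _ jr)[[P Q] /= [GP /nbhs_singleton Qq] PQ].
  change (G [set t | N (Cr_jet j (h t) q)]).
  by apply: filterS GP => t Pt; exact: (PQ (t, q)).
pose a (t : R) al := Cr_ext0 (fun z => Cr_jet k (h al) (z, power_init y)) (set_val x + t *: y ord_max).
pose b (t : R) al := Cr_ext0 (fun z => Cr_jet k.+1 (h al) (z, y)) (set_val x + t *: y ord_max).
rewrite /is_dir_deriv.
apply: (@cvg_iterated R F R T _ G (fun t al => t^-1 *: (a t al - a 0 al)) _ (g k.+1 (x, y))).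
  apply: (@slopes_cvg R F T _ a b).
    exists ([set t : R | exists2 x' : U, set_val x' = set_val x + t *: y ord_max & U° (set_val x')],
      [set al | Cr r (h al)]).
      by split=> //; exact: near_line_lift.
    move=> [t al] /= [[x' xt Ux'] Cal]; apply/is_dir_deriv_curve.
    by rewrite /b -xt Cr_ext0E; exact: Cr_jet_deriv Cal kr Ux'.
  apply: (@cvg_line_ext0 _ _ (fun z al => Cr_jet k.+1 (h al) (z, y))) => //.
  move=> N /(hg _ _ kr)[[P Q] /= [GP [[Q1 Q2] /= [xQ1 /nbhs_singleton yQ2] Q12]] PQ].
  exists (Q1, P) => // -[z al] /= [Q1z Pal]; apply: (PQ (al, (z, y))).
  by split=> //; exact: (Q12 (z, y)).
have : \forall t \near (0 : R)^', exists2 x' : U,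
    set_val x' = set_val x + t *: y ord_max & U° (set_val x').
  by apply: nbhs_dnbhs; exact: near_line_lift.
apply: filterS => t [x' xt Ux']; rewrite /a -xt scale0r addr0 !Cr_ext0E.
apply: cvg_scaler; first exact: cvg_cst.
under eq_fun do rewrite !Cr_ext0E -scaleN1r.
rewrite -scaleN1r; apply: cvg_addr; first exact/pt/order_leS.
by apply: cvg_scaler; [exact: cvg_cst|exact/pt/order_leS].
Qed.

(** In the interior this is [iter_deriv_polarization]; both sides are continuous
    up to the boundary. *)
Lemma Cr_polarization r k (f : U -> F) x (y : cartesian_power E k) :
  Cr r f -> order_le k r ->
  (k`!)%:R *: Cr_jet k f (x, y) =
  \sum_(S : {set 'I_k}) (polar_sign S : R) *: Cr_jet k f (x, fun=> \sum_(i in S) y i).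
Proof.
move=> Cf kr; have cf := Cr_jet_continuous Cf kr.
have ct (z : cartesian_power E k) : continuous (fun x => Cr_jet k f (x, z)).
  by move=> x' N /cf; exact: cvg_pairl.
pose lhs x := (k`!)%:R *: Cr_jet k f (x, y) : F.
pose rhs x := \sum_(S : {set 'I_k}) (polar_sign S : R) *:
  Cr_jet k f (x, (fun=> \sum_(i in S) y i) : cartesian_power E k).
suff : lhs = rhs by move=> /(congr1 (fun f => f x)).
apply: (dense_eq (Cr_dense U)).
- move=> x'; apply: (cvg_scaler (nbhs_filter x') (@cvg_cst _ _ _ _ _) (@ct y x')).
- move=> x'; apply: (@cvg_sumr R F U _ (nbhs x') (index_enum {set 'I_k}) xpredT (fun S x => (polar_sign S : R) *:
  Cr_jet k f (x, (fun=> \sum_(i in S) y i) : cartesian_power E k))) => S.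
  apply: (cvg_scaler (nbhs_filter x') (@cvg_cst _ _ _ _ _) (@ct (fun=> \sum_(i in S) y i) x')).
- move=> x' Ux'; rewrite /lhs /rhs (Cr_jetE _ Cf)//.
  rewrite (iter_deriv_polarization _ (@open_interior _ _) Ux' (smooth_on_Cr Cf kr)).
  by apply: eq_bigr => S _; rewrite (Cr_jetE _ Cf)// Cr_dirs_const.
Qed.

End limits_of_jets.

Section topology_of_Cr.
Context {R : realType} {E : lcsType R} {r : option nat} {U : lcsubset E} {F : lcsType R}.

Lemma Cr_cvgP (T : Type) (G : set_system T) (h : T -> Crmap r U F) (f : Crmap r U F) :
  Filter G -> h @ G --> f <->
  forall k (K : set (U * cartesian_power E k)) W, order_le k r -> compact K -> nbhs (0 : F) W ->
    \forall t \near G, forall q, K q -> W (Cr_jet k (h t) q - Cr_jet k f q).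
Proof.
move=> FG; split=> [/(initial_lcs_cvgP (@Cr_d_continuous R E r U F) (@Cr_cvg R E r U F)) H k K W kr|H].
  exact: (H (exist _ k kr)).
apply/(initial_lcs_cvgP (@Cr_d_continuous R E r U F) (@Cr_cvg R E r U F)) => -[k kr] K W.
exact: H.
Qed.

(** Convergence is checked jointly in t and near each point q; a finite cover
    makes it uniform on compact sets. *)
Lemma cvg_Cr (T : Type) (G : set_system T) (h : T -> Crmap r U F) (f : Crmap r U F) :
  Filter G ->
  (forall k q, order_le k r ->
    (fun p => Cr_jet k (h p.1) p.2) @ filter_prod G (nbhs q) --> Cr_jet k f q) ->
  h @ G --> f.
Proof.
move=> FG H; apply/Cr_cvgP => k K W kr cK W0.
move/compact_near_coveringP/near_covering_withinP : (cK).
move=> /(_ T G (fun t q => W (Cr_jet k (h t) q - Cr_jet k f q)) FG); apply => q Kq.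
have [W' W'0 W'W] := nbhs0_sub W0.
have cf : {for q, continuous (Cr_jet k f)} by exact: (Cr_jet_continuous (CrP f) kr).
have [[P Q] /= [GP Qq] PQ] := H k q kr _ (nbhs_translate (Cr_jet k f q) W'0).
exists (Q `&` Cr_jet k f @^-1` [set z | W' (z - Cr_jet k f q)], P).
  by split=> //; apply: filterI => //; apply: cf; exact: nbhs_translate.
move=> [q' t] /= [[Qq' Wq'] Pt] Kq'.
have -> : Cr_jet k (h t) q' - Cr_jet k f q' =
    (Cr_jet k (h t) q' - Cr_jet k f q) - (Cr_jet k f q' - Cr_jet k f q).
  by rewrite opprB addrA subrK.
by apply: W'W => //; exact: (PQ (t, q')).
Qed.

End topology_of_Cr.

(** * Partial derivatives on a product *)

Section slices.
Context {R : realType} {E1 E2 : tvsType R} {F : lcsType R}.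
Implicit Types (psi : E1 * E2 -> F).

(** Stated as an equality of predicates in the limit, so that the chosen value
    [dir_deriv] is transported even where no derivative exists. *)
Lemma is_dir_deriv_snd psi x y v :
  is_dir_deriv psi (x, y) (0, v) = is_dir_deriv (fun y' => psi (x, y')) y v.
Proof.
apply/funext => l; rewrite /is_dir_deriv.
have -> : (fun t : R => t^-1 *: (psi ((x, y) + t *: ((0, v) : E1 * E2)) - psi (x, y))) =
    (fun t : R => t^-1 *: (psi (x, y + t *: v) - psi (x, y))).
  apply/funext => t; congr (_ *: (psi _ - _)).
  by apply/pair_equal_spec; split => //=; rewrite scaler0 addr0.
by [].
Qed.

Lemma is_dir_deriv_fst psi x y w :
  is_dir_deriv psi (x, y) (w, 0) = is_dir_deriv (fun x' => psi (x', y)) x w.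
Proof.
apply/funext => l; rewrite /is_dir_deriv.
have -> : (fun t : R => t^-1 *: (psi ((x, y) + t *: ((w, 0) : E1 * E2)) - psi (x, y))) =
    (fun t : R => t^-1 *: (psi (x + t *: w, y) - psi (x, y))).
  apply/funext => t; congr (_ *: (psi _ - _)).
  by apply/pair_equal_spec; split => //=; rewrite scaler0 addr0.
by [].
Qed.

Lemma iter_deriv_snd vs psi x y :
  iter_deriv [seq (0, v) | v <- vs] psi (x, y) = iter_deriv vs (fun y' => psi (x, y')) y.
Proof.
elim: vs psi => //= v vs IH psi; rewrite IH; congr (iter_deriv vs _ y).
by apply/funext => y'; rewrite /dir_deriv is_dir_deriv_snd.
Qed.

Lemma iter_deriv_fst ws psi x y :
  iter_deriv [seq (w, 0) | w <- ws] psi (x, y) = iter_deriv ws (fun x' => psi (x', y)) x.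
Proof.
elim: ws psi => //= w ws IH psi; rewrite IH; congr (iter_deriv ws _ x).
by apply/funext => x'; rewrite /dir_deriv is_dir_deriv_fst.
Qed.

Lemma iter_derivable_snd (O1 : set E1) (O2 : set E2) vs psi :
  (forall x, O1 x -> iter_derivable O2 vs (fun y => psi (x, y))) ->
  iter_derivable (O1 `*` O2) [seq (0, v) | v <- vs] psi.
Proof.
elim: vs psi => //= v vs IH psi H; split.
  move=> [x y] [/= Ox Oy]; have [/(_ y Oy)[l dl] _] := H x Ox.
  by exists l; rewrite is_dir_deriv_snd.
apply: IH => x Ox; have [_] := H x Ox; congr iter_derivable.
by apply/funext => y; rewrite /dir_deriv is_dir_deriv_snd.
Qed.

Lemma iter_derivable_fst (O1 : set E1) (O2 : set E2) ws psi :
  (forall y, O2 y -> iter_derivable O1 ws (fun x => psi (x, y))) ->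
  iter_derivable (O1 `*` O2) [seq (w, 0) | w <- ws] psi.
Proof.
elim: ws psi => //= w ws IH psi H; split.
  move=> [x y] [/= Ox Oy]; have [/(_ x Ox)[l dl] _] := H y Oy.
  by exists l; rewrite is_dir_deriv_fst.
apply: IH => y Oy; have [_] := H y Oy; congr iter_derivable.
by apply/funext => x; rewrite /dir_deriv is_dir_deriv_fst.
Qed.

End slices.

Section mixed_jets.
Context {R : realType} {E1 E2 : lcsType R} {U : lcsubset E1} {V : lcsubset E2} {F : lcsType R}.
Implicit Types (f : U * V -> F).

Lemma Crs_dirsE i j (w : cartesian_power E1 i) (v : cartesian_power E2 j) :
  Crs_dirs (w, v) = [seq (0, e) | e <- Cr_dirs v] ++ [seq (e, 0) | e <- Cr_dirs w].
Proof. by rewrite /Crs_dirs /Cr_dirs /image_mem -!map_comp. Qed.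

Lemma Crs_dirsS i j (w : cartesian_power E1 i.+1) (v : cartesian_power E2 j) :
  Crs_dirs (w, v) = rcons (Crs_dirs (power_init w, v)) (w ord_max, 0).
Proof. by rewrite !Crs_dirsE [Cr_dirs w]Cr_dirsS map_rcons rcons_cat. Qed.

Lemma Crs_dirs0S j (w : cartesian_power E1 0) (v : cartesian_power E2 j.+1) :
  Crs_dirs (w, v) = rcons (Crs_dirs (w, power_init v)) (0, v ord_max).
Proof. by rewrite !Crs_dirsE [Cr_dirs v]Cr_dirsS map_rcons Cr_dirs0 !cats0. Qed.

Lemma Crs_ext0E f x y : Crs_ext0 f (set_val x, set_val y) = f (x, y).
Proof.
have := congr1 (fun g => g (@sigT_of_setX E1 E2 U V (x, y)))
  (@valLK _ _ 0 _ (f \o @setX_of_sigT E1 E2 U V)).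
rewrite [RHS]/= (@sigT_of_setXK E1 E2 U V).
exact.
Qed.

(** An equality of functions on all of E2: both sides vanish off V. *)
Lemma Crs_ext0_slice f x :
  (fun y => Crs_ext0 f (set_val x, y)) = Cr_ext0 (fun y => f (x, y)).
Proof.
apply/funext => y; case: (pselect (lcsubset_set V y)) => [/mem_set Vy|Vy].
  by rewrite -[y]/(set_val (exist _ y Vy : V)) Crs_ext0E Cr_ext0E.
rewrite /Crs_ext0 /Cr_ext0 /= !oinv_set_val !insubF//.
  by apply/negbTE/negP => /set_mem.
by apply/negbTE/negP => /set_mem[].
Qed.

Definition Crs_jet i j f :
    U * V * (cartesian_power E1 i * cartesian_power E2 j) -> F :=
  the_deriv_ext (@Crs_dirs R E1 E2 i j) (Crs_interior U V) (@Crs_incl R E1 E2 U V) (Crs_ext0 f) f.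
Arguments Crs_jet : clear implicits.

Variables (r s : option nat) (f : U * V -> F).
Hypothesis Cf : Crs r s f.

Lemma Crs_jetP i j : order_le i r -> order_le j s ->
  deriv_ext (@Crs_dirs R E1 E2 i j) (Crs_interior U V) (@Crs_incl R E1 E2 U V)
    (Crs_ext0 f) f (Crs_jet i j f).
Proof. by move=> ir js; apply: the_deriv_extP; have [_] := Cf ir js. Qed.

Lemma Crs_jet_continuous i j : order_le i r -> order_le j s -> continuous (Crs_jet i j f).
Proof. by move=> ir js; have [] := Crs_jetP ir js. Qed.

Lemma Crs_jet00 p q : Crs_jet 0 0 f (p, q) = f p.
Proof.
have [_ _] := Crs_jetP (order_le0 r) (order_le0 s); apply; case: q => w v.
by rewrite Crs_dirsE !Cr_dirs0.
Qed.

Lemma Crs_jetE i j x y w v : order_le i r -> order_le j s ->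
  U° (set_val x) -> V° (set_val y) ->
  Crs_jet i j f (x, y, (w, v)) =
  iter_deriv (Crs_dirs (w, v)) (Crs_ext0 f) (set_val x, set_val y).
Proof. by move=> ir js Ux Vy; have [_ ->] := Crs_jetP ir js. Qed.

Lemma Crs_jet_deriv1 i j x y (w : cartesian_power E1 i.+1) v :
  order_le i.+1 r -> order_le j s -> U° (set_val x) -> V° (set_val y) ->
  is_dir_deriv (Cr_ext0 (fun x' => Crs_jet i j f (x', y, (power_init w, v)))) (set_val x)
    (w ord_max) (Crs_jet i.+1 j f (x, y, (w, v))).
Proof.
move=> ir js Ux Vy; rewrite Crs_jetE// Crs_dirsS iter_deriv_rcons.
have [[/(_ (w, v)) df _] _] := Cf ir js; move: df.
rewrite Crs_dirsS iter_derivable_rcons => -[_ dd].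
have Oxy : Crs_interior U V (set_val x, set_val y) by [].
have := dir_derivP (dd _ Oxy); rewrite is_dir_deriv_fst.
apply: (is_dir_deriv_eq (@open_interior _ _) Ux) => z Uz.
have [x' x'z] := interior_lift Uz; rewrite -x'z Cr_ext0E Crs_jetE ?x'z//.
exact: order_leS.
Qed.

Lemma Crs_jet_deriv2 j x y w (v : cartesian_power E2 j.+1) :
  order_le j.+1 s -> U° (set_val x) -> V° (set_val y) ->
  is_dir_deriv (Cr_ext0 (fun y' => Crs_jet 0 j f (x, y', (w, power_init v)))) (set_val y)
    (v ord_max) (Crs_jet 0 j.+1 f (x, y, (w, v))).
Proof.
move=> js Ux Vy; rewrite Crs_jetE ?order_le0// Crs_dirs0S iter_deriv_rcons.
have [[/(_ (w, v)) df _] _] := Cf (order_le0 r) js; move: df.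
rewrite Crs_dirs0S iter_derivable_rcons => -[_ dd].
have Oxy : Crs_interior U V (set_val x, set_val y) by [].
have := dir_derivP (dd _ Oxy); rewrite is_dir_deriv_snd.
apply: (is_dir_deriv_eq (@open_interior _ _) Vy) => z Vz.
have [y' y'z] := interior_lift Vz; rewrite -y'z Cr_ext0E Crs_jetE ?y'z//.
  exact: order_le0.
exact: order_leS.
Qed.

End mixed_jets.
Arguments Crs_jet {R E1 E2 U V F} i j f.

(** * From a C^{r,s}-map to a map into the space of C^s-maps *)

Lemma Cr_jet_lin (R : realType) (E : lcsType R) (U : lcsubset E) (F : lcsType R) r k
    (a : R) (f g : U -> F) : Cr r f -> Cr r g -> order_le k r ->
  Cr_jet k (a *: f + g) = a *: Cr_jet k f + Cr_jet k g.
Proof.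
move=> Cf Cg kr; have [df _] := Cf k kr; have [dg _] := Cg k kr.
have L := deriv_ext_lin (@open_interior _ _) a df dg (Cr_jetP Cf kr) (Cr_jetP Cg kr).
rewrite -Cr_ext0_lin in L.
by have K := the_deriv_extE (Cr_dense U) L; exact: K.
Qed.

Lemma Cr_lin (R : realType) (E : lcsType R) (U : lcsubset E) (F : lcsType R) r
    (a : R) (f g : U -> F) : Cr r f -> Cr r g -> Cr r (a *: f + g).
Proof.
move=> Cf Cg; have [_ H] := Cr_submod_closed r U F.
by have /set_mem := H a f g (mem_set Cf) (mem_set Cg).
Qed.

Section currying.
Context {R : realType} {E1 E2 : lcsType R} {U : lcsubset E1} {V : lcsubset E2} {F : lcsType R}.
Variables (r s : option nat) (f : U * V -> F).
Hypothesis Cf : Crs r s f.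

(** The map d^(k,j) f with the arguments grouped as they are for a map from
    U x E1^k to the jets of maps on V. *)
Definition partial_jet k j (x : U) (w : cartesian_power E1 k)
  (q : V * cartesian_power E2 j) : F := Crs_jet k j f (x, q.1, (w, q.2)).

(** The entry fun=> 0 is the only point of E2^0. *)
Definition partial_deriv k (x : U) (w : cartesian_power E1 k) (y : V) : F :=
  partial_jet (j := 0) x w (y, fun=> 0).

Lemma partial_jet0 k x (w : cartesian_power E1 k) y (z : cartesian_power E2 0) :
  partial_jet x w (y, z) = partial_deriv x w y.
Proof. by congr (partial_jet _ _ (_, _)); apply/funext => -[]. Qed.

Lemma continuous_partial_jet k j : order_le k r -> order_le j s ->
  continuous (fun p : (U * cartesian_power E1 k) * (V * cartesian_power E2 j) =>
    partial_jet p.1.1 p.1.2 p.2).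
Proof.
move=> kr js; apply: (continuous_compose (@continuous_shuffle _ _ _ _) (Crs_jet_continuous Cf kr js)).
Qed.

Lemma continuous_partial_jet_dir k j (w : cartesian_power E1 k) :
  order_le k r -> order_le j s ->
  continuous (fun p : U * (V * cartesian_power E2 j) => partial_jet p.1 w p.2).
Proof.
move=> kr js; apply: (continuous_compose (f := fun p : U * (V * cartesian_power E2 j) => ((p.1, w), p.2))
  _ (continuous_partial_jet kr js)).
by continuous_projections.
Qed.

Lemma continuous_partial_jet_at k j x (w : cartesian_power E1 k) :
  order_le k r -> order_le j s -> continuous (@partial_jet k j x w).
Proof.
move=> kr js q A /(@continuous_partial_jet_dir k j w kr js (x, q)) H.
by have := cvg_pairr H.
Qed.

Lemma partial_jet_quotient k j x (w : cartesian_power E1 k.+1) (q : V * cartesian_power E2 j) :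
  order_le k.+1 r -> order_le j s -> U° (set_val x) ->
  (fun p : R * (V * cartesian_power E2 j) => p.1^-1 *:
     (Cr_ext0 (fun z => partial_jet z (power_init w) p.2) (set_val x + p.1 *: w ord_max)
      - partial_jet x (power_init w) p.2))
    @ filter_prod (0 : R)^' (nbhs q) --> partial_jet x w q.
Proof.
move=> kr js Ux.
have := @partial_difference_quotient R E1 U F _ [set q | V° (set_val q.1)]
  (fun p => partial_jet p.1 (power_init w) p.2) (fun p => partial_jet p.1 w p.2)
  x (w ord_max) q.
apply => //.
- exact: (@closure_fst V _ [set y | V° (set_val y)] (Cr_dense V)).
- exact/continuous_partial_jet_dir/js/order_leS.
- exact/continuous_partial_jet_dir.
- by move=> x' [y v] Ux' Vy; exact: (Crs_jet_deriv1 Cf kr js Ux' Vy).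
Qed.

Let partial_smooth k x (w : cartesian_power E1 k) :=
  Cr s (partial_deriv x w) /\ forall j, order_le j s -> Cr_jet j (partial_deriv x w) = partial_jet x w.

(** Every x in U is a limit of interior points x', and the jets at x' converge
    to those at x as d^(k,j) f is continuous on U x V x E1^k x E2^j. *)
Lemma partial_smooth_boundary k (w : cartesian_power E1 k) : order_le k r ->
  (forall x, U° (set_val x) -> partial_smooth x w) -> forall x, partial_smooth x w.
Proof.
move=> kr H x.
apply: (@Cr_closed R E2 V F s U (within [set x | U° (set_val x)] (nbhs x))
  (fun x' => partial_deriv x' w) _ (fun j => @partial_jet k j x w)).
- exact/within_proper/Cr_dense.
- by apply: filterS (@withinT _ (nbhs x) [set x | U° (set_val x)] _) => x' /H[].
- by move=> j js; exact: continuous_partial_jet_at.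
- by move=> y z; exact: partial_jet0.
- move=> j q js N /(@continuous_partial_jet_dir k j w kr js (x, q))[[P Q] /= [Px Qq] PQ].
  exists (P `&` [set x | U° (set_val x)], Q).
    split=> //; change (nbhs x [set z | U° (set_val z) -> P z /\ U° (set_val z)]).
    by apply: filterS Px => z.
  by move=> [z q'] /= [[Pz Uz] Qq']; have [_ ->//] := H z Uz; exact: (PQ (z, q')).
Qed.

(** Induction on k.  For interior x the map y |-> d^(k+1,0) f (x, y, w) is the
    limit of difference quotients in x of the C^s-maps given by the induction
    hypothesis; their jets are difference quotients of d^(k,j) f, which converge
    by [partial_jet_quotient].  Differentiating in x after all the derivatives
    in y, as d^(k,j) f does, is what makes these jets come out right. *)
Lemma partial_deriv_smooth k x (w : cartesian_power E1 k) : order_le k r -> partial_smooth x w.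
Proof.
elim: k x w => [|k IH] x w kr; apply: partial_smooth_boundary => // {}x Ux.
  apply: Cr_intro.
  - by move=> j js; exact: continuous_partial_jet_at.
  - by move=> y z; exact: partial_jet0.
  - by move=> j y v js Vy; exact: (Crs_jet_deriv2 Cf js Ux Vy).
have kr' := order_leS kr.
pose h (t : R) (y : V) : F := t^-1 *: (Cr_ext0 (fun z => partial_deriv z (power_init w) y)
  (set_val x + t *: w ord_max) - partial_deriv x (power_init w) y).
have hE (t : R) x' : set_val x' = set_val x + t *: w ord_max ->
    h t = t^-1 *: partial_deriv x' (power_init w) + (- t^-1) *: partial_deriv x (power_init w).
  move=> x't; apply/funext => y.
  by rewrite /h -x't Cr_ext0E scalerBr !fctE scaleNr.
(* The quotients h t make sense only for t so small that x + t w stays in U. *)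
have near_lift : \forall t \near (0 : R)^', exists2 x' : U,
    set_val x' = set_val x + t *: w ord_max & U° (set_val x').
  by apply: nbhs_dnbhs; exact: near_line_lift.
(* Adding 0 puts a multiple in the form a *: f + g of [Cr_lin]. *)
have Z0 (g : V -> F) a : a *: g = a *: g + 0 by rewrite addr0.
have Ch t x' : set_val x' = set_val x + t *: w ord_max -> Cr s (h t) /\
    forall j, order_le j s -> Cr_jet j (h t) =
      (fun q => t^-1 *: (partial_jet x' (power_init w) q - partial_jet x (power_init w) q)).
  move=> /hE ->; have [C1 J1] := IH x' (power_init w) kr'.
  have [C2 J2] := IH x (power_init w) kr'.
  have C0 : Cr s (0 : V -> F) by have [/set_mem] := Cr_submod_closed s V F.
  rewrite [- t^-1 *: _]Z0; have C3 := Cr_lin (- t^-1) C2 C0.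
  split; first exact: Cr_lin.
  move=> j js; rewrite (Cr_jet_lin _ C1 C3)// J1// (Cr_jet_lin _ C2 C0)// J2//.
  have -> : Cr_jet j (0 : V -> F) = 0.
    have := Cr_jet_lin (-1) C0 C0 js; rewrite scaler0 addr0 => ->.
    by rewrite scaleN1r addNr.
  by apply/funext => q; rewrite !fctE addr0 scaleNr -scalerBr.
apply: (@Cr_closed R E2 V F s R (0 : R)^' h _ (fun j => @partial_jet k.+1 j x w)).
- by apply: filterS near_lift => t [x' /Ch[]].
- by move=> j js; exact: continuous_partial_jet_at.
- by move=> y z; exact: partial_jet0.
- move=> j q js; have L := @partial_jet_quotient k j x w q kr js Ux.
  apply: cvg_trans L; apply: near_eq_cvg.
  exists ([set t : R | exists2 x' : U, set_val x' = set_val x + t *: w ord_max & U° (set_val x')], setT).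
    by split=> //; exact: filterT.
  move=> [t q'] /= [[x' x't _] _].
  by have [_ ->//] := Ch t x' x't; rewrite -x't Cr_ext0E.
Qed.

End currying.

(** * The map f |-> f^vee and the topologies *)

Section jets_of_Crmap.
Context {R : realType} {E : lcsType R} {r : option nat} {U : lcsubset E} {F : lcsType R}.
Implicit Types (f g : Crmap r U F).

Lemma Cr_jetD k f g q : order_le k r -> Cr_jet k (f + g) q = Cr_jet k f q + Cr_jet k g q.
Proof. by move=> kr; exact: (@LD _ _ _ _ _ _ (@Cr_d_lin R E r U F) (exist _ k kr) f g q). Qed.

Lemma Cr_jetZ k a f q : order_le k r -> Cr_jet k (a *: f) q = a *: Cr_jet k f q.
Proof. by move=> kr; exact: (@LZ _ _ _ _ _ _ (@Cr_d_lin R E r U F) (exist _ k kr) a f q). Qed.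

Lemma Cr_jetB k f g q : order_le k r -> Cr_jet k (f - g) q = Cr_jet k f q - Cr_jet k g q.
Proof. by move=> kr; exact: (@LB _ _ _ _ _ _ (@Cr_d_lin R E r U F) (exist _ k kr) f g q). Qed.

Lemma Cr_jetZB k a f g q : order_le k r ->
  Cr_jet k (a *: (f - g)) q = a *: (Cr_jet k f q - Cr_jet k g q).
Proof. by move=> kr; rewrite Cr_jetZ// Cr_jetB. Qed.

Lemma Cr_jet_zero k q : order_le k r -> Cr_jet k (0 : Crmap r U F) q = 0.
Proof. by move=> kr; exact: (@L0 _ _ _ _ _ _ (@Cr_d_lin R E r U F) (exist _ k kr) q). Qed.

End jets_of_Crmap.

Section vee.
Context {R : realType} {E1 E2 : lcsType R} {U : lcsubset E1} {V : lcsubset E2} {F : lcsType R}.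
Context {r s : option nat}.

(** The default value 0 of insubd is never reached for k <= r. *)
Definition vee_jet (f : Crsmap r s U V F) k (p : U * cartesian_power E1 k) : Crmap s V F :=
  insubd (0 : Crmap s V F) (partial_deriv f p.1 p.2).
Arguments vee_jet : clear implicits.

Definition vee (f : Crsmap r s U V F) (x : U) : Crmap s V F := vee_jet f 0 (x, fun=> 0).

Lemma vee_jetE f k x w : order_le k r ->
  crfun (vee_jet f k (x, w)) = partial_deriv f x w.
Proof.
move=> kr; apply: insubdK; have [C _] := partial_deriv_smooth (CrsP f) x w kr.
exact: mem_set.
Qed.

Lemma veeE f x y : vee f x y = f (x, y).
Proof.
rewrite /vee vee_jetE ?order_le0//.
exact: Crs_jet00 (CrsP f) _ _.
Qed.

Lemma Cr_jet_vee_jet f k j x w q : order_le k r -> order_le j s ->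
  Cr_jet j (vee_jet f k (x, w)) q = partial_jet f x w q.
Proof.
move=> kr js; rewrite vee_jetE//.
by have [_ ->] := partial_deriv_smooth (CrsP f) x w kr.
Qed.

(** Convergence to a C^s-map is tested on jets by [cvg_Cr], and there the
    difference quotients of f^vee become those of d^(k,j) f. *)
Lemma vee_smooth f : Cr r (vee f) /\ forall k, order_le k r -> Cr_jet k (vee f) = vee_jet f k.
Proof.
apply: Cr_intro => [k kr [x w]|x y|k x w kr Ux].
- apply: cvg_Cr => j q js; rewrite Cr_jet_vee_jet// => A.
  move=> /(@continuous_partial_jet _ _ _ _ _ _ _ _ _ (CrsP f) k j kr js ((x, w), q))[[P Q] /= [Px Qq] PQ].
  exists (P, Q) => // -[[x' w'] q'] /= [Px' Qq']; rewrite /= Cr_jet_vee_jet//.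
  exact: (PQ ((x', w'), q')).
- by rewrite /vee; congr (vee_jet f 0 (_, _)); apply/funext => -[].
- rewrite /is_dir_deriv; apply: cvg_Cr => j q js; rewrite Cr_jet_vee_jet//.
  have E (t : R) q' (x' : U) : set_val x' = set_val x + t *: w ord_max ->
      t^-1 *: (Cr_ext0 (fun z => partial_jet f z (power_init w) q') (set_val x + t *: w ord_max)
        - partial_jet f x (power_init w) q') =
      Cr_jet j (t^-1 *: (Cr_ext0 (fun z => vee_jet f k (z, power_init w))
        (set_val x + t *: w ord_max) -
        Cr_ext0 (fun z => vee_jet f k (z, power_init w)) (set_val x))) q'.
    by move=> <-; rewrite !Cr_ext0E Cr_jetZB// !Cr_jet_vee_jet// order_leS.
  have L := @partial_jet_quotient _ _ _ _ _ _ r s f (CrsP f) k j x w q kr js Ux.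
  apply: cvg_trans L; apply: near_eq_cvg.
  exists ([set t : R | exists2 x' : U, set_val x' = set_val x + t *: w ord_max & U° (set_val x')], setT).
    split=> /=; last exact: filterT.
    by apply: nbhs_dnbhs; exact: near_line_lift.
  by move=> [t q'] [[x' x't _] _]; exact: (E t q' x' x't).
Qed.

Definition Vee (f : Crsmap r s U V F) : Crmap r U (Crmap s V F) :=
  MkCrmap (mem_set (vee_smooth f).1 : vee f \in @Cr_pred R E1 r U (Crmap s V F)).

Lemma VeeE f x y : Vee f x y = f (x, y). Proof. exact: veeE. Qed.

Lemma Cr_jet_Vee f k j x w y v : order_le k r -> order_le j s ->
  Cr_jet j (Cr_jet k (Vee f) (x, w)) (y, v) = Crs_jet k j f (x, y, (w, v)).
Proof. by move=> kr js; rewrite (vee_smooth f).2// Cr_jet_vee_jet. Qed.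

Lemma Crs_cvgP (T : Type) (G : set_system T) (h : T -> Crsmap r s U V F) (f : Crsmap r s U V F) :
  Filter G -> h @ G --> f <->
  forall i j (K : set (U * V * (cartesian_power E1 i * cartesian_power E2 j))) W,
    order_le i r -> order_le j s -> compact K -> nbhs (0 : F) W ->
    \forall t \near G, forall q, K q -> W (Crs_jet i j (h t) q - Crs_jet i j f q).
Proof.
have P := initial_lcs_cvgP (@Crs_d_continuous R E1 E2 r s U V F) (@Crs_cvg R E1 E2 r s U V F).
move=> FG; split=> [hf i j K W ir js|H].
  have ijrs : order_le (i, j).1 r && order_le (i, j).2 s by rewrite ir js.
  exact: ((P f T h G FG).1 hf (exist _ (i, j) ijrs) K W).
apply: (P f T h G FG).2 => -[[i j] ijrs] K W; have /andP[ir js] := ijrs.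
exact: H.
Qed.

Lemma linear_Vee : linear Vee.
Proof.
move=> a f g; apply/val_inj/funext => x; apply/val_inj/funext => y.
have -> : val (val (Vee (a *: f + g)) x) y = (a *: f + g : Crsmap r s U V F) (x, y) by exact: VeeE.
transitivity (a *: Vee f x y + Vee g x y); last by [].
by rewrite !VeeE.
Qed.

(** Both topologies express uniform convergence of the maps d^(k,j) f on compact
    sets, because the compact subsets of a product are contained in products of
    compact sets. *)
Lemma Vee_cvg (T : Type) (G : set_system T) (h : T -> Crsmap r s U V F) (f : Crsmap r s U V F) :
  Filter G -> h @ G --> f <-> (Vee \o h) @ G --> Vee f.
Proof.
move=> FG; split=> [/Crs_cvgP hf|/Cr_cvgP hf].
  apply/Cr_cvgP => k K W' kr cK W'0.
  (* The sets that eventually contain all the differences of k-th jets on K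
     form a filter; it suffices that it converges to 0. *)
  pose Q : set_system (Crmap s V F) := [set A | \forall t \near G, forall q, K q ->
    A (Cr_jet k (Vee (h t)) q - Cr_jet k (Vee f) q)].
  have FQ : Filter Q.
    split.
    - by apply: nearW => t q _.
    - move=> A B QA QB; apply: (@filterS T G FG _ _ _ (@filterI T G FG _ _ QA QB)).
      by move=> t [At Bt] q Kq; split; [exact: At|exact: Bt].
    - by move=> A B AB QA; apply: (@filterS T G FG _ _ _ QA) => t At q Kq; exact/AB/At.
  suff : (fun phi : Crmap s V F => phi) @ Q --> (0 : Crmap s V F) by move=> /(_ _ W'0).
  apply/Cr_cvgP => j L W js cL W0.
  pose sh (p : (U * cartesian_power E1 k) * (V * cartesian_power E2 j)) :=
    ((p.1.1, p.2.1), (p.1.2, p.2.2)).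
  have cKL : compact (sh @` (K `*` L)).
    apply: continuous_compact; last exact: compact_setX.
    exact/continuous_subspaceT/continuous_shuffle.
  apply: filterS (hf k j _ W kr js cKL W0) => t Wt [x w] Kxw [y v] Lyv.
  rewrite Cr_jet_zero// subr0 Cr_jetB// !Cr_jet_Vee//.
  by apply: Wt; exists ((x, w), (y, v)).
apply/Crs_cvgP => i j K W ir js cK W0.
pose K1 := (fun p : U * V * (cartesian_power E1 i * cartesian_power E2 j) => (p.1.1, p.2.1)) @` K.
pose L := (fun p : U * V * (cartesian_power E1 i * cartesian_power E2 j) => (p.1.2, p.2.2)) @` K.
have cK1 : compact K1.
  by apply: continuous_compact cK; apply: continuous_subspaceT; continuous_projections.
have cL : compact L.
  by apply: continuous_compact cK; apply: continuous_subspaceT; continuous_projections.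
have W'0 : nbhs (0 : Crmap s V F) [set phi | forall q, L q -> W (Cr_jet j phi q - Cr_jet j (0 : Crmap s V F) q)].
  by have /Cr_cvgP := @cvg_id _ (nbhs (0 : Crmap s V F)); apply.
apply: filterS (hf i K1 _ ir cK1 W'0) => t Wt [[x y] [w v]] Kq.
rewrite -!Cr_jet_Vee// -Cr_jetB//.
have := Wt (x, w) _ (y, v); rewrite Cr_jet_zero// subr0; apply.
  by exists ((x, y), (w, v)).
by exists ((x, y), (w, v)).
Qed.

End vee.

(** * Evaluation of maps into the space of C^s-maps *)

Section continuous_linear.
Context {R : realType} {G : tvsType R} {F1 F2 : lcsType R} (L : F1 -> F2).
Hypotheses (cL : continuous L)
  (ZB : forall (a : R) (f g : F1), L (a *: (f - g)) = a *: (L f - L g)).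

Lemma is_dir_deriv_linear (phi : G -> F1) x h l :
  is_dir_deriv phi x h l -> is_dir_deriv (L \o phi) x h (L l).
Proof.
move=> d; have := @cvg_comp _ _ _ _ _ _ _ _ d (@cL l).
by apply: cvg_trans; apply: near_eq_cvg; apply: nearW => t /=; rewrite ZB.
Qed.

Lemma iter_deriv_linear (O : set G) hs (phi : G -> F1) : open O ->
  iter_derivable O hs phi -> iter_derivable O hs (L \o phi) /\
    (forall x, O x -> iter_deriv hs (L \o phi) x = L (iter_deriv hs phi x)).
Proof.
move=> oO; elim: hs phi => //= h hs IH phi [d1 /IH[d2 E2]].
have E x : O x -> (L \o dir_deriv h phi) x = dir_deriv h (L \o phi) x.
  by move=> Ox; apply/esym/dir_derivE/is_dir_deriv_linear/dir_derivP/d1.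
have [d3 E3] := iter_deriv_eq oO E d2.
split; last by move=> x Ox; rewrite -E3// E2.
split=> // x Ox; exists (L (dir_deriv h phi x)).
exact/is_dir_deriv_linear/dir_derivP/d1.
Qed.

End continuous_linear.

(** Points are compact. *)
Lemma Cr_jet_eval_continuous (R : realType) (E F : lcsType R) r (U : lcsubset E) k q :
  order_le k r -> continuous (fun phi : Crmap r U F => Cr_jet k phi q).
Proof.
move=> kr phi A /nbhs_translate0 A0; have /Cr_cvgP H := @cvg_id _ (nbhs phi).
apply: filterS (H k [set q] _ kr (@compact_set1 _ q) A0) => psi /(_ q erefl) /=.
by rewrite addrC subrK.
Qed.

Section evaluation.
Context {R : realType} {E F : lcsType R} {s : option nat} {V : lcsubset E}.
Variables (Z : topologicalType) (j : nat) (Gamma : Z -> Crmap s V F)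
  (beta : Z -> V * cartesian_power E j).
Hypotheses (js : order_le j s) (cG : continuous Gamma) (cb : continuous beta).

(** Convergence of Gamma z is uniform on L, so evaluation at a moving point
    beta z is under control as long as beta z stays in L. *)
Lemma eval_near_compact z0 (L : set (V * cartesian_power E j)) A : compact L ->
  nbhs (Cr_jet j (Gamma z0) (beta z0)) A ->
  \forall z \near z0, L (beta z) -> A (Cr_jet j (Gamma z) (beta z)).
Proof.
move=> cL /nbhs_translate0/nbhs0_add[W W0 WA].
have /Cr_cvgP H := @cG z0.
have N1 := H j L W js cL W0.
have cj : continuous (fun z => Cr_jet j (Gamma z0) (beta z)).
  exact: continuous_compose cb (Cr_jet_continuous (CrP (Gamma z0)) js).
have N2 : nbhs z0 [set z | W (Cr_jet j (Gamma z0) (beta z) - Cr_jet j (Gamma z0) (beta z0))].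
  exact: (cj z0 _ (nbhs_translate _ W0)).
apply: filterS (filterI N1 N2) => z [W1 W2] Lz.
by have := WA _ _ (W1 _ Lz) W2; rewrite /= [X in A X]addrC addrA !subrK.
Qed.

(** On a compact set K of points z the evaluation points beta z stay in the
    compact set beta @` K. *)
Lemma eval_continuous_k_space : k_space Z -> continuous (fun z => Cr_jet j (Gamma z) (beta z)).
Proof.
move=> [_ kZ]; apply/continuousP => O oO; apply/kZ => K cK.
rewrite openE => z Oz.
have cL : compact (beta @` K).
  by apply: continuous_compact cK; apply: continuous_subspaceT.
have N := eval_near_compact cL (open_nbhs_nbhs (conj oO Oz)).
have ci : continuous (set_val : K -> Z) by exact: initial_continuous.
apply: (@filterS _ (nbhs z) _ _ _ _ (ci z _ N)) => x; apply; exists (set_val x) => //.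
exact: set_valP.
Qed.

Lemma eval_continuous_locally_compact :
  (forall q : V * cartesian_power E j, exists2 L, nbhs q L & compact L) ->
  continuous (fun z => Cr_jet j (Gamma z) (beta z)).
Proof.
move=> lc z A zA; have [L zL cL] := lc (beta z).
have N : nbhs z (beta @^-1` L) by exact: cb.
by apply: filterS (filterI N (eval_near_compact cL zA)) => z' [Lz' Az']; exact: Az'.
Qed.

End evaluation.

Section local_compactness.
Context {R : realType} {E : lcsType R} {V : lcsubset E}.

(** V has interior points, being nonempty with dense interior; a compact
    neighbourhood of such a point in V can be translated to any point of E. *)
Lemma compact_nbhs_ambient : locally_compact [set: V] -> V ->
  forall e : E, exists2 B, nbhs e B & compact B.
Proof.
move=> lc y1 e.
have : closure [set y : V | V° (set_val y)] y1 by rewrite Cr_dense.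
move=> /(_ _ filterT)[y0 [Vy0 _]].
have [B] := lc y0 I; rewrite withinET => y0B [cB _].
pose tr (z : E) := z - set_val y0 + e.
have ctr : continuous tr.
  move=> z; apply: cvg_addr; last exact: cvg_cst.
  by apply: cvg_addr; [exact: cvg_id|exact: cvg_cst].
exists (tr @` (set_val @` B)).
  have back : (fun z : E => z - e + set_val y0) @ e --> set_val y0.
    rewrite -[X in _ --> X]add0r -(subrr e).
    apply: cvg_addr; last exact: cvg_cst.
    by apply: cvg_addr; [exact: cvg_id|exact: cvg_cst].
  apply: filterS (cvg_near back (nbhs_lift Vy0 y0B)) => z [y' [y'z _ By']].
  by exists (set_val y'); [exists y'|rewrite y'z /tr addrK subrK].
apply: continuous_compact; first exact: continuous_subspaceT.
apply: continuous_compact cB; apply: continuous_subspaceT.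
exact: initial_continuous.
Qed.

Lemma compact_nbhs_power k : locally_compact [set: V] ->
  forall q : V * cartesian_power E k, exists2 L, nbhs q L & compact L.
Proof.
move=> lc [y v].
have [B] := lc y I; rewrite withinET => yB [cB _].
have H i : exists A : set E, nbhs (v i) A /\ compact A.
  by have [A ? ?] := compact_nbhs_ambient lc y (v i); exists A.
have [A HA] := choice H.
exists (B `*` [set w : cartesian_power E k | forall i, A i (w i)]).
  exists (B, [set w : cartesian_power E k | forall i, A i (w i)]) => //; split=> //=.
  apply: (@filter_forall (cartesian_power E k) 'I_k (fun i w => A i (w i)) (nbhs v)) => i; have [vA _] := HA i.
  exact: (@proj_continuous _ (fun _ : 'I_k => E) i v _ vA).
apply: compact_setX => //; apply: (@tychonoff _ (fun _ : 'I_k => E)) => i.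
by have [] := HA i.
Qed.

End local_compactness.

(** * From a map into the space of C^s-maps to a C^{r,s}-map *)

Section wedge.
Context {R : realType} {E1 E2 : lcsType R} {U : lcsubset E1} {V : lcsubset E2} {F : lcsType R}.
Context {r s : option nat}.
Variable g : U -> Crmap s V F.
Hypothesis Cg : Cr r g.

Definition wedge (p : U * V) : F := g p.1 p.2.

(** The candidate for d^(i,j) of g^wedge. *)
Definition wedge_jet i j (p : U * V * (cartesian_power E1 i * cartesian_power E2 j)) : F :=
  Cr_jet j (Cr_jet i g (p.1.1, p.2.1)) (p.1.2, p.2.2).

(** For fixed y and v, taking the j-th jet at (y, v) is a continuous linear map
    on the space of C^s-maps, hence it commutes with the derivatives of g. *)
Lemma wedge_iter_slice i j (w : cartesian_power E1 i) (v : cartesian_power E2 j) (y : V) :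
  order_le i r -> order_le j s -> V° (set_val y) ->
  let phi x := iter_deriv (Cr_dirs v) (fun y' => Crs_ext0 wedge (x, y')) (set_val y) in
  iter_derivable U° (Cr_dirs w) phi /\
  forall x : U, U° (set_val x) ->
    iter_deriv (Cr_dirs w) phi (set_val x) = wedge_jet ((x, y), (w, v)).
Proof.
move=> ir js Vy phi.
pose L (h : Crmap s V F) : F := Cr_jet j h (y, v).
have cL : continuous L by exact: Cr_jet_eval_continuous.
have LZB a h1 h2 : L (a *: (h1 - h2)) = a *: (L h1 - L h2) by exact: Cr_jetZB.
have [[/(_ w) dg _] _] := Cg ir.
have [dL EL] := iter_deriv_linear cL LZB (@open_interior _ _) dg.
(* In the interior of U the slices of g^wedge are values of L along g. *)
have Lphi z : U° z -> (L \o Cr_ext0 g) z = phi z.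
  move=> Uz; have [x xz] := interior_lift Uz; rewrite -xz /phi /= Cr_ext0E.
  rewrite (Crs_ext0_slice wedge x) /L (Cr_jetE _ (CrP (g x)))//.
have [dphi Ephi] := iter_deriv_eq (@open_interior _ _) Lphi dL.
split=> // x Ux; rewrite -Ephi// EL// /wedge_jet /=.
by rewrite (Cr_jetE _ Cg).
Qed.

(** In the interior the derivatives of g^wedge are computed slice by slice with
    [wedge_iter_slice]; [wedge_jet] then serves as their extension to the
    boundary. *)
Lemma wedge_smooth :
  (forall i j, order_le i r -> order_le j s -> continuous (@wedge_jet i j)) ->
  Crs r s wedge.
Proof.
move=> cw i j ir js.
have D (w : cartesian_power E1 i) (v : cartesian_power E2 j) : iter_derivable (Crs_interior U V) (Crs_dirs (w, v)) (Crs_ext0 wedge).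
  rewrite Crs_dirsE iter_derivable_cat; split.
    apply: iter_derivable_snd => z Uz; have [x xz] := interior_lift Uz.
    rewrite -xz (Crs_ext0_slice wedge x).
    by have [[/(_ v)]] := CrP (g x) js.
  apply: iter_derivable_fst => z Vz; have [y yz] := interior_lift Vz.
  rewrite -yz in Vz *; have [d _] := wedge_iter_slice w v ir js Vz.
  by under eq_fun do rewrite iter_deriv_snd.
have J x y (w : cartesian_power E1 i) (v : cartesian_power E2 j) : U° (set_val x) -> V° (set_val y) ->
    iter_deriv (Crs_dirs (w, v)) (Crs_ext0 wedge) (set_val x, set_val y) =
    @wedge_jet i j ((x, y), (w, v)).
  move=> Ux Vy; have [_ <-//] := wedge_iter_slice w v ir js Vy.
  rewrite Crs_dirsE iter_deriv_cat iter_deriv_fst; congr (iter_deriv _ _ _).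
  by apply/funext => z; rewrite iter_deriv_snd.
split; last first.
  exists (@wedge_jet i j); split; first exact: cw.
    by move=> [x y] [w v] [/= Ux Vy]; rewrite -J.
  case: i j ir js {D J} => [|i] [|j] ir js [x y] [w v] E.
  - by rewrite /wedge_jet /= (Cr_jet0 _ _ (CrP _)) (Cr_jet0 _ _ Cg).
  - by move: E; rewrite Crs_dirs0S; case: (Crs_dirs _).
  - by move: E; rewrite Crs_dirsS; case: (Crs_dirs _).
  - by move: E; rewrite Crs_dirsS; case: (Crs_dirs _).
split=> [[w v]//|].
apply: (within_image_continuous (incl := @Crs_incl R E1 E2 U V) _ _ _ (cw i j ir js)).
- exact: open_Crs_interior.
- move=> [x y] P [/= Ux Vy] [[A B] /= [Ax By] AB].
  exists ([set z | exists x' : U, [/\ set_val x' = z, U° z & A x']],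
          [set z | exists y' : V, [/\ set_val y' = z, V° z & B y']]).
    by split; [exact: (nbhs_lift Ux Ax)|exact: (nbhs_lift Vy By)].
  move=> [z1 z2] /= [[x' [<- _ Ax']] [y' [<- _ By']]].
  by exists (x', y') => //; exact: (AB (x', y')).
- move=> [z1 z2] [/= /interior_lift[x <-] /interior_lift[y <-]].
  by exists (x, y).
- by move=> [x y] [w v] [/= Ux Vy]; rewrite J.
Qed.

Lemma wedge_jet_polarization i j x y (w : cartesian_power E1 i) (v : cartesian_power E2 j) :
  order_le i r -> order_le j s ->
  (i`!)%:R *: ((j`!)%:R *: wedge_jet ((x, y), (w, v))) =
  \sum_(S : {set 'I_i}) (polar_sign S : R) *: \sum_(T : {set 'I_j}) (polar_sign T : R) *:
    wedge_jet ((x, y), ((fun=> \sum_(l in S) w l) : cartesian_power E1 i,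
                        (fun=> \sum_(l in T) v l) : cartesian_power E2 j)).
Proof.
move=> ir js.
have lin (I : Type) (a : I -> R) (h : I -> Crmap s V F) (l : seq I) q :
    Cr_jet j (\sum_(k <- l) a k *: h k : Crmap s V F) q = \sum_(k <- l) a k *: Cr_jet j (h k) q.
  elim: l => [|k l IH]; first by rewrite !big_nil Cr_jet_zero.
  by rewrite !big_cons Cr_jetD// Cr_jetZ// IH.
transitivity ((j`!)%:R *: Cr_jet j ((i`!)%:R *: Cr_jet i g (x, w) : Crmap s V F) (y, v)).
  by rewrite Cr_jetZ// !scalerA mulrC.
rewrite (Cr_polarization _ _ Cg ir) lin scaler_sumr; apply: eq_bigr => S _.
rewrite scalerA mulrC -scalerA; congr (_ *: _).
exact: (Cr_polarization _ _ (CrP _) js).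
Qed.

(** By polarization in both groups of directions, [wedge_jet] is a linear
    combination of its values with all the directions in E1 equal and all those
    in E2 equal. *)
Lemma wedge_jet_diagonal i j : order_le i r -> order_le j s ->
  continuous (fun p : U * V * E1 * E2 =>
    wedge_jet (p.1.1, ((fun=> p.1.2) : cartesian_power E1 i,
                       (fun=> p.2) : cartesian_power E2 j))) ->
  continuous (@wedge_jet i j).
Proof.
move=> ir js cd.
pose N (p : U * V * E1 * E2) : F := wedge_jet (p.1.1, ((fun=> p.1.2) : cartesian_power E1 i,
                       (fun=> p.2) : cartesian_power E2 j)).
have csum k (E : lcsType R) (S : {set 'I_k}) :
    continuous (fun w : cartesian_power E k => \sum_(l in S) w l).
  move=> w; apply: (@cvg_sumr R E (cartesian_power E k) 'I_k (nbhs w) _ _ (fun l w => w l)) => l.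
  exact: (@proj_continuous _ (fun _ : 'I_k => E) l w).
have -> : @wedge_jet i j = fun p => (i`!)%:R^-1 *: ((j`!)%:R^-1 *:
    \sum_(S : {set 'I_i}) (polar_sign S : R) *: \sum_(T : {set 'I_j}) (polar_sign T : R) *:
      N (p.1, \sum_(l in S) p.2.1 l, \sum_(l in T) p.2.2 l)).
  apply/funext => -[[x y] [w v]] /=.
  have fact0 n : (n`!)%:R != 0 :> R by rewrite pnatr_eq0 -lt0n fact_gt0.
  by rewrite /N /= -wedge_jet_polarization// !scalerA mulrACA mulVf// mul1r mulVf// scale1r.
move=> p; apply: cvg_scaler; first exact: cvg_cst.
apply: cvg_scaler; first exact: cvg_cst.
apply: (@cvg_sumr R F _ _ (nbhs p) _ _ (fun S p => (polar_sign S : R) *: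
  \sum_(T : {set 'I_j}) (polar_sign T : R) *:
  N (p.1, \sum_(l in S) p.2.1 l, \sum_(l in T) p.2.2 l))) => S.
apply: cvg_scaler; first exact: cvg_cst.
apply: (@cvg_sumr R F _ _ (nbhs p) _ _ (fun T p => (polar_sign T : R) *:
  N (p.1, \sum_(l in S) p.2.1 l, \sum_(l in T) p.2.2 l))) => T.
apply: cvg_scaler; first exact: cvg_cst.
apply: (continuous_compose
  (f := fun p : U * V * (cartesian_power E1 i * cartesian_power E2 j) =>
    (p.1, \sum_(l in S) p.2.1 l, \sum_(l in T) p.2.2 l)) _ cd).
apply: continuous_pair; first apply: continuous_pair.
- by continuous_projections.
- by apply: continuous_compose (csum _ _ S); continuous_projections.
- by apply: continuous_compose (csum _ _ T); continuous_projections.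
Qed.

End wedge.

(** * The exponential law *)

(** The one place where the alternative hypotheses enter.  If V is locally
    compact, so is V x E2^j, and evaluation is continuous.  Otherwise a k-space
    with at most one factor E1 and one factor E2 controls the restriction of
    [wedge_jet] to equal directions, and [wedge_jet_diagonal] does the rest. *)
Lemma wedge_jet_continuous (R : realType) (E1 E2 F : lcsType R)
    (U : lcsubset E1) (V : lcsubset E2) (r s : option nat)
    (H : locally_compact [set: V] \/
         [/\ r = Some 0%N, s = Some 0%N & k_space (U * V)%type] \/
         [/\ order_le 1 r, s = Some 0%N & k_space (U * V * E1)%type] \/
         [/\ r = Some 0%N, order_le 1 s & k_space (U * V * E2)%type] \/
         [/\ order_le 1 r, order_le 1 s & k_space (U * V * E1 * E2)%type])
    (g : U -> Crmap s V F) (Cg : Cr r g) i j :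
  order_le i r -> order_le j s -> continuous (@wedge_jet R E1 E2 U V F s g i j).
Proof.
move=> ir js.
have cg := Cr_jet_continuous Cg ir.
case: H => [lc|H].
  apply: (@eval_continuous_locally_compact _ _ _ s V _ j
    (fun p : U * V * (cartesian_power E1 i * cartesian_power E2 j) => Cr_jet i g (p.1.1, p.2.1))
    (fun p => (p.1.2, p.2.2)) js).
  - by apply: continuous_compose cg; continuous_projections.
  - by continuous_projections.
  - exact: compact_nbhs_power.
apply: (wedge_jet_diagonal Cg ir js).
have diag (Z : topologicalType) (pr : U * V * E1 * E2 -> Z) (a : Z -> U)
    (b : Z -> V) (c : Z -> cartesian_power E1 i) (d : Z -> cartesian_power E2 j) :
  k_space Z -> continuous pr -> continuous a -> continuous b -> continuous c -> continuous d ->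
  (forall p, wedge_jet g (p.1.1, ((fun=> p.1.2) : cartesian_power E1 i, (fun=> p.2) : cartesian_power E2 j))
     = wedge_jet g ((a (pr p), b (pr p)), (c (pr p), d (pr p)))) ->
  continuous (fun p : U * V * E1 * E2 => wedge_jet g
    (p.1.1, ((fun=> p.1.2) : cartesian_power E1 i, (fun=> p.2) : cartesian_power E2 j))).
  move=> kZ cpr ca cb cc cd E; rewrite (funext E).
  apply: (continuous_compose cpr (g := fun z => wedge_jet g ((a z, b z), (c z, d z)))).
  apply: (@eval_continuous_k_space _ _ _ s V Z j (fun z => Cr_jet i g (a z, c z))
    (fun z => (b z, d z)) js) => //.
    by apply: continuous_compose cg; exact: continuous_pair.
  exact: continuous_pair.
(* With no direction at all, the entry fun=> e is the same for every e. *)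
have pow0 (E : lcsType R) k (e e' : cartesian_power E k) : k = 0%N -> e = e'.
  by move=> k0; subst k; apply/funext => -[].
case: H => [[r0 s0 kZ]|[[_ s0 kZ]|[[r0 _ kZ]|[_ _ kZ]]]].
- have i0 : i = 0%N by apply/eqP; move: ir; rewrite r0 /order_le leqn0.
  have j0 : j = 0%N by apply/eqP; move: js; rewrite s0 /order_le leqn0.
  apply: (diag _ (fun p => p.1.1) fst snd (fun=> fun=> 0) (fun=> fun=> 0) kZ); try by continuous_projections.
  by move=> [[[x y] e1] e2] /=; congr (wedge_jet g (_, (_, _))); exact: pow0.
- have j0 : j = 0%N by apply/eqP; move: js; rewrite s0 /order_le leqn0.
  apply: (diag _ (fun p => p.1) (fun z => z.1.1) (fun z => z.1.2)
    (fun z => fun=> z.2) (fun=> fun=> 0) kZ); try by continuous_projections.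
    by apply: continuous_compose (@continuous_diagonal _ _); continuous_projections.
  by move=> [[[x y] e1] e2] /=; congr (wedge_jet g (_, (_, _))); exact: pow0.
- have i0 : i = 0%N by apply/eqP; move: ir; rewrite r0 /order_le leqn0.
  apply: (diag _ (fun p => (p.1.1, p.2)) (fun z => z.1.1) (fun z => z.1.2)
    (fun=> fun=> 0) (fun z => fun=> z.2) kZ); try by continuous_projections.
    by apply: continuous_compose (@continuous_diagonal _ _); continuous_projections.
  by move=> [[[x y] e1] e2] /=; congr (wedge_jet g (_, (_, _))); exact: pow0.
- apply: (diag _ id (fun z => z.1.1.1) (fun z => z.1.1.2)
    (fun z => fun=> z.1.2) (fun z => fun=> z.2) kZ); try by continuous_projections.
  + by apply: continuous_compose (@continuous_diagonal _ _); continuous_projections.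
  + by apply: continuous_compose (@continuous_diagonal _ _); continuous_projections.
Qed.

Theorem theorem3p28 (R : realType) (E1 E2 F : lcsType R)
    (U : lcsubset E1) (V : lcsubset E2) (r s : option nat)
    (H : locally_compact [set: V] \/
         [/\ r = Some 0%N, s = Some 0%N & k_space (U * V)%type] \/
         [/\ order_le 1 r, s = Some 0%N & k_space (U * V * E1)%type] \/
         [/\ r = Some 0%N, order_le 1 s & k_space (U * V * E2)%type] \/
         [/\ order_le 1 r, order_le 1 s & k_space (U * V * E1 * E2)%type]) :
  (exists Phi : Crsmap r s U V F -> Crmap r U (Crmap s V F),
    (forall f x y, Phi f x y = f (x, y)) /\ tvs_isomorphism Phi) /\
  (forall g : U -> Crmap s V F, Cr r g -> Crs r s (fun p : U * V => g p.1 p.2)).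
Proof.
have Cw (g : U -> Crmap s V F) : Cr r g -> Crs r s (wedge g).
  by move=> Cg; apply: (wedge_smooth Cg) => i j; exact: wedge_jet_continuous H _ Cg i j.
split; last exact: Cw.
pose Psi (g : Crmap r U (Crmap s V F)) : Crsmap r s U V F :=
  MkCrsmap (mem_set (Cw g (CrP g)) : wedge g \in @Crs_pred R E1 E2 r s U V F).
have VeePsi : cancel Psi Vee.
  by move=> g; apply/val_inj/funext => x; apply/val_inj/funext => y; exact: VeeE.
exists Vee; split; first exact: VeeE.
split; first exact: linear_Vee.
  move=> f; exact: (Vee_cvg id f (nbhs_filter f)).1 (@cvg_id _ _).
exists Psi; split => //.
  by move=> f; apply/val_inj/funext => -[x y]; exact: VeeE.
move=> g; apply: (Vee_cvg Psi (Psi g) (nbhs_filter g)).2.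
rewrite VeePsi (_ : Vee \o Psi = id); last exact/funext.
exact: cvg_id.
Qed.
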